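(* Let $\kappa>0$, $J(\xi)=\kappa\|\xi\|^2$ for $\xi\in\mathbb R^2$, and let the time-varying cost be $J(x-\gamma(t))$ with $\gamma:\mathbb R^+\to\mathbb R^2$. Let $\rho>0$, $\widetilde D=\{\xi\in\mathbb R^2: J(\xi)\le\rho\}$, and let $F_1,F_2\in C(\mathbb R;\mathbb R)$ satisfy $$F_2(z)=-F_1(z)\int\frac{dz}{F_1(z)^2}.$$ Assume that: (B1) $F_i\circ J\in C^2(\widetilde D\setminus\{0\};\mathbb R)$, $L_{F_j}(F_i\circ J)\in C(\widetilde D;\mathbb R)$, and $L_{F_k}L_{F_j}(F_i\circ J)\in C(\widetilde D;\mathbb R)$ for all $i,j,k\in\{1,2\}$; (B2) the first-order partial derivatives of $F_i\circ J$ and of $L_{F_i}(F_j\circ J)$ are uniformly bounded in $\widetilde D\setminus\{0\}$ for all $i,j\in\{1,2\}$; (B3) $\gamma\in C^1(\mathbb R^+;\mathbb R^2)$, and there exists $\nu>0$ such that $\|\dot\gamma(t)\|\le\nu$ for all $t\in\mathbb R^+$. Then, for any $\lambda\in(0,\rho)$, $\delta\in\Big(0,\frac{\sqrt\rho-\sqrt\lambda}{\sqrt\kappa}\Big)$ and $\vartheta>\frac{\nu}{2\sqrt{\kappa\lambda}}$, the family of sets $$\mathcal L_{\lambda,t}=\{x\in\mathbb R^2: J(x-\gamma(t))\le\lambda\},\quad t\in\mathbb R^+,$$ is practically uniformly asymptotically stable, with initial conditions $x(t_0)=x^0\in B_\delta(\mathcal L_{\lambda,t_0})$, for the unicycle system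 $$\dot x_1=u\cos(\Omega t),\qquad \dot x_2=u\sin(\Omega t)$$ with the control $$u=\sqrt{\vartheta\alpha\omega}\,\big(F_1(J(x-\gamma(t)))\cos(\omega t)+F_2(J(x-\gamma(t)))\sin(\omega t)\big),\quad \omega=k\Omega,\ \alpha=4(1-k^{-2}),\ k\in\mathbb N,\ k>1.$$
   Context: $\mathbb R^+$ is the set of non-negative reals. For a family of non-empty sets $\mathcal L_t\subset\mathbb R^2$, $t\in\mathbb R^+$, $B_\delta(\mathcal L_t)=\bigcup_{y\in\mathcal L_t}\{x\in\mathbb R^2:\|x-y\|<\delta\}$. The integer $k$ is fixed; $\omega$ is the parameter in the stability notions below and $\Omega=\omega/k$. Meaning of the integral relation between $F_1$ and $F_2$: it is assumed that $F_1(z)\ne0$ except for at most a countable set $Z^*$ of isolated zeros; $\Psi_1(z)=\int\frac{dz}{F_1(z)^2}$ denotes an antiderivative of $1/F_1^2$ on $\mathbb R\setminus Z^*$, and the relation means $F_2(z)=-F_1(z)\Psi_1(z)$ for $z\notin Z^*$ and $F_2(z^* )=-\lim_{z\to z^*}F_1(z)\Psi_1(z)$ for $z^*\in Z^*$. Lie derivatives: for a vector field $g$ and a function (or vector field) $h$, $L_gh(\xi)=\lim_{y\to0}\frac1y\big(h(\xi+yg(\xi))-h(\xi)\big)$. The symbols $L_{F_j}(F_i\circ J)$ and $L_{F_k}L_{F_j}(F_i\circ J)$ in (B1), (B2) are shorthand for the Lie derivatives of $F_i\circ J$ along the vector fields $(F_j\circ J)e_p$, respectively iterated along $(F_j\circ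 J)e_p$ and then $(F_k\circ J)e_q$, for all $p,q\in\{1,2\}$, where $e_1=(1,0)^T$, $e_2=(0,1)^T$; the conditions are required for all such $p,q$. Stability notion (for a system depending on a parameter $\omega>0$, with $x(t_0)=x^0$): a family $\mathcal L_t$, $t\in\mathbb R^+$, is practically uniformly asymptotically stable with $x^0\in B_\delta(\mathcal L_{t_0})$ if the following three properties hold, for solutions with initial conditions in $B_\delta(\mathcal L_{t_0})$: - practical uniform stability: for any $\varepsilon>0$ there exist $\delta'\in(0,\delta]$ and $\omega_0>0$ such that, for all $t_0\in\mathbb R^+$ and $\omega>\omega_0$, $x^0\in B_{\delta'}(\mathcal L_{t_0})$ implies $x(t)\in B_\varepsilon(\mathcal L_t)$ for all $t\ge t_0$; - $\delta$-practical uniform attractivity: for every $\varepsilon>0$ there exist $t_1\ge0$ and $\omega_0>0$ such that, for all $t_0\in\mathbb R^+$ and $\omega>\omega_0$, $x^0\in B_\delta(\mathcal L_{t_0})$ implies $x(t)\in B_\varepsilon(\mathcal L_t)$ for all $t\ge t_0+t_1$; - practical uniform boundedness: for each $\delta'\in(0,\delta]$ there are $\varepsilon>0$ and $\omega_0>0$ such that, for all $t_0\in\mathbb R^+$ and $\omega>\omega_0$, $x^0\in B_{\delta'}(\mathcal L_{t_0})$ implies $x(t)\in B_\varepsilon(\mathcal L_t)$ for all $t\ge t_0$. *)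

(* Defs.v *)
From Stdlib Require Import Reals.
From Coquelicot Require Import Coquelicot.

Open Scope R_scope.

(** ** The Euclidean plane *)

(* Coquelicot's norm on a product is [sqrt (norm (fst x) ^ 2 + norm (snd x) ^ 2)],
   so [norm] below is the Euclidean norm. *)
Definition plane : NormedModule R_AbsRing :=
  prod_NormedModule R_AbsRing R_NormedModule R_NormedModule.

Inductive index : Set := one | two.

Definition e (p : index) : plane :=
  match p with one => (1, 0) | two => (0, 1) end.

Definition interior (A : plane -> Prop) : plane -> Prop :=
  fun xi => locally xi A.

(** ** Derivatives and regularity classes *)

Definition is_partial (p : index) (h : plane -> R) (xi : plane) (l : R) : Prop :=
  is_derive (fun s => h (plus xi (scal s (e p)))) 0 l.

Definition partial (p : index) (h : plane -> R) (xi : plane) : R :=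
  Derive (fun s => h (plus xi (scal s (e p)))) 0.

Definition is_Lie (g : plane -> plane) (h : plane -> R) (xi : plane) (l : R) : Prop :=
  is_lim (fun y => / y * (h (plus xi (scal y (g xi))) - h xi)) 0 l.

(* The total function underlying [is_Lie]; meaningful where the limit exists. *)
Definition Lie (g : plane -> plane) (h : plane -> R) (xi : plane) : R :=
  real (Lim (fun y => / y * (h (plus xi (scal y (g xi))) - h xi)) 0).

(* The (partially defined) derivative with graph [P] is of class C(A): it
   exists in the interior of [A] and extends continuously to [A].  This is the
   usual meaning of C^m on a set with boundary; no differentiability across
   the boundary of [A] is required. *)
Definition is_C0 (A : plane -> Prop) (P : plane -> R -> Prop) : Prop :=
  exists g : plane -> R,
    continuous_on A g /\ forall xi, interior A xi -> P xi (g xi).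

Definition is_C2 (A : plane -> Prop) (h : plane -> R) : Prop :=
  continuous_on A h /\
  (forall p, is_C0 A (is_partial p h)) /\
  (forall p q, is_C0 A (is_partial q (partial p h))).

Definition bounded_partials (A : plane -> Prop) (h : plane -> R) : Prop :=
  exists M : R, forall (q : index) (xi : plane), interior A xi ->
    exists l : R, is_partial q h xi l /\ Rabs l <= M.

(* One-sided at an endpoint of the interval [I]. *)
Definition is_derive_within (I : R -> Prop) (x : R -> plane) (t : R) (v : plane) : Prop :=
  filterlim (fun s => scal (/ (s - t)) (minus (x s) (x t)))
    (within I (locally' t)) (locally v).

(** ** The cost and the generating functions *)

Definition J (kappa : R) (xi : plane) : R := kappa * norm xi ^ 2.

Definition Dtilde (kappa rho : R) (xi : plane) : Prop := J kappa xi <= rho.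

Definition Dtilde0 (kappa rho : R) (xi : plane) : Prop :=
  Dtilde kappa rho xi /\ xi <> zero.

(* [Psi] may use a different integration constant on each component of the
   complement of the zero set of [F one]. *)
Definition integral_relation (F : index -> R -> R) : Prop :=
  (exists enum : nat -> R, forall z, F one z = 0 -> exists n, enum n = z) /\
  (forall z, F one z = 0 -> locally' z (fun y => F one y <> 0)) /\
  exists Psi : R -> R,
    (forall z, F one z <> 0 -> is_derive Psi z (1 / F one z ^ 2)) /\
    (forall z, F one z <> 0 -> F two z = - (F one z * Psi z)) /\
    (forall z, F one z = 0 -> exists l : R,
        is_lim (fun y => F one y * Psi y) z l /\ F two z = - l).

Definition FJ (kappa : R) (F : index -> R -> R) (i : index) (xi : plane) : R :=
  F i (J kappa xi).

Definition FJfield (kappa : R) (F : index -> R -> R) (j p : index) (xi : plane) : plane :=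
  scal (FJ kappa F j xi) (e p).

Definition condition_B1 (kappa rho : R) (F : index -> R -> R) : Prop :=
  (forall i, is_C2 (Dtilde0 kappa rho) (FJ kappa F i)) /\
  (forall i j p,
     is_C0 (Dtilde kappa rho) (is_Lie (FJfield kappa F j p) (FJ kappa F i))) /\
  (forall i j k p q,
     is_C0 (Dtilde kappa rho)
       (is_Lie (FJfield kappa F k q) (Lie (FJfield kappa F j p) (FJ kappa F i)))).

Definition condition_B2 (kappa rho : R) (F : index -> R -> R) : Prop :=
  (forall i, bounded_partials (Dtilde0 kappa rho) (FJ kappa F i)) /\
  (forall i j p,
     bounded_partials (Dtilde0 kappa rho)
       (Lie (FJfield kappa F i p) (FJ kappa F j))).

Definition condition_B3 (gamma : R -> plane) (nu : R) : Prop :=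
  0 < nu /\
  exists dgamma : R -> plane,
    continuous_on (fun t => 0 <= t) dgamma /\
    forall t, 0 <= t ->
      is_derive_within (fun s => 0 <= s) gamma t (dgamma t) /\ norm (dgamma t) <= nu.

(** ** Practical uniform asymptotic stability *)

Definition nbhd (delta : R) (L : plane -> Prop) (x : plane) : Prop :=
  exists y, L y /\ norm (minus x y) < delta.

Definition solution (f : R -> plane -> plane) (t0 : R) (x0 : plane) (T : Rbar)
    (x : R -> plane) : Prop :=
  Rbar_lt t0 T /\ x t0 = x0 /\
  forall t, t0 <= t -> Rbar_lt t T ->
    is_derive_within (fun s => t0 <= s /\ Rbar_lt s T) x t (f t (x t)).

(* "x(t) lies in S(t) for all t >= t1", where x is the solution with
   x(t0) = x0.  As uniqueness and global existence are not known a priori for a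
   merely continuous right-hand side, this says that a solution exists, that
   every solution continues to the whole of [t0, +oo), and that all solutions
   satisfy the inclusion. *)
Definition solutions_in (f : R -> plane -> plane) (t0 : R) (x0 : plane)
    (t1 : R) (S : R -> plane -> Prop) : Prop :=
  (exists x, solution f t0 x0 p_infty x) /\
  (forall T x, solution f t0 x0 T x ->
     exists y, solution f t0 x0 p_infty y /\
       forall t, t0 <= t -> Rbar_lt t T -> y t = x t) /\
  (forall x, solution f t0 x0 p_infty x -> forall t, t1 <= t -> S t (x t)).

(* A system is a map [f : omega -> t -> x -> dx/dt]. *)
Definition practically_uniformly_stable (f : R -> R -> plane -> plane)
    (L : R -> plane -> Prop) (delta : R) : Prop :=
  forall eps, 0 < eps ->
  exists delta' omega0, 0 < delta' <= delta /\ 0 < omega0 /\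
  forall t0 omega x0, 0 <= t0 -> omega0 < omega -> nbhd delta' (L t0) x0 ->
    solutions_in (f omega) t0 x0 t0 (fun t => nbhd eps (L t)).

Definition practically_uniformly_attractive (f : R -> R -> plane -> plane)
    (L : R -> plane -> Prop) (delta : R) : Prop :=
  forall eps, 0 < eps ->
  exists t1 omega0, 0 <= t1 /\ 0 < omega0 /\
  forall t0 omega x0, 0 <= t0 -> omega0 < omega -> nbhd delta (L t0) x0 ->
    solutions_in (f omega) t0 x0 (t0 + t1) (fun t => nbhd eps (L t)).

Definition practically_uniformly_bounded (f : R -> R -> plane -> plane)
    (L : R -> plane -> Prop) (delta : R) : Prop :=
  forall delta', 0 < delta' <= delta ->
  exists eps omega0, 0 < eps /\ 0 < omega0 /\
  forall t0 omega x0, 0 <= t0 -> omega0 < omega -> nbhd delta' (L t0) x0 ->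
    solutions_in (f omega) t0 x0 t0 (fun t => nbhd eps (L t)).

Definition practically_uniformly_asymptotically_stable
    (f : R -> R -> plane -> plane) (L : R -> plane -> Prop) (delta : R) : Prop :=
  practically_uniformly_stable f L delta /\
  practically_uniformly_attractive f L delta /\
  practically_uniformly_bounded f L delta.

(** ** The controlled unicycle *)

Definition level_sets (kappa lambda : R) (gamma : R -> plane) (t : R) (x : plane) : Prop :=
  J kappa (minus x (gamma t)) <= lambda.

Definition unicycle (k : nat) (u : R -> R -> plane -> R)
    (omega t : R) (x : plane) : plane :=
  let Omega := omega / INR k in
  (u omega t x * cos (Omega * t), u omega t x * sin (Omega * t)).

Definition control (kappa theta : R) (k : nat) (F : index -> R -> R)
    (gamma : R -> plane) (omega t : R) (x : plane) : R :=
  let alpha := 4 * (1 - / INR k ^ 2) in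
  let z := J kappa (minus x (gamma t)) in
  sqrt (theta * alpha * omega) *
    (F one z * cos (omega * t) + F two z * sin (omega * t)).

(* Main.v *)
Require Import Defs.
From Stdlib Require Import Reals Lra Lia.
From Coquelicot Require Import Coquelicot.

(** The idea is averaging by a corrected energy.  Write [xi = x - gamma],
    [z = J xi], [q = 1/k], [s = sqrt omega], and use the components [p], [r] of
    [xi] along and across the heading [(cos (q omega t), sin (q omega t))]:
[[
      p' =   q omega r + g s (F1(z) cos (omega t) + F2(z) sin (omega t)) + drift
      r' = - q omega p + drift,            g^2 = 4 theta (1 - q^2)
]]
    Every quantity that matters is a polynomial in [p], [r], the two
    trigonometric functions and the derivatives of [F1], [F2] at [z], and time
    differentiation splits as [omega D0 + s D1 + D2] with derivations [D0]
    (phase), [D1] (input), [D2] (drift).  One looks for correctors [G1], [G2]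
    with [D0 G1 = D1 z], which cancels the [s]-term of [z'], and with
    [D0 G2 = D1 G1 - mean].  Then [W = z - G1/s + G2/omega] satisfies
    [W' = D2 z - mean + O(1/s)].  The frequencies of [D1 z] are [1 + q] and
    [1 - q], nonzero because [k > 1], so [G1] exists.  In the mean of [D1 G1]
    only the term with [F2 F1' - F1 F2'] survives; the integral relation makes
    that Wronskian equal to 1, and the mean is [4 kappa theta z]: on average
    the control descends along the gradient of [J].  This is
    [averaged_decrease].

    On the annulus [lambda <= z <= rho'] with [rho' < rho] the generators are
    of class C2, so the O(1/s) is uniform, and
    [D2 z - mean <= - 2 w (2 theta w - nu)] with [w = sqrt (kappa z)], which is
    negative by the choice of [theta] ([annular_decrease]).  Nothing has to be
    known where [z < lambda]: a continuous [z] that is within [eta] of a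
    function decreasing on the annulus cannot climb from [a] to [b > a + 2 eta]
    ([barrier]) and must come down to [lambda] in bounded time ([entry]).
    These two facts give the three stability properties.

    Existence and continuation of solutions come from holding the
    generators constant beyond [rho'].  The bounded gradients of [F_i o J] make this clipped
    system globally Lipschitz and bounded, so it has a unique solution for all times
    ([picard_existence], [lipschitz_unique]); the barrier keeps every solution
    of either system below [rho'], where the two systems agree
    ([solutions_in_sublevel]). *)

(** * The Euclidean plane *)

Lemma norm_sqr (xi : plane) : norm xi ^ 2 = fst xi ^ 2 + snd xi ^ 2.
Proof.
  destruct xi as [a b]. unfold norm at 1; simpl. unfold prod_norm; simpl.
  rewrite !Rmult_1_r, sqrt_sqrt.
  - unfold norm; simpl. unfold abs; simpl.
    now rewrite <- !Rabs_mult, !Rabs_pos_eq by apply Rle_0_sqr.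
  - unfold norm; simpl. unfold abs; simpl. pose proof (Rabs_pos a). pose proof (Rabs_pos b). nra.
Qed.

Lemma inner_le_norms (x y : plane) : fst x * fst y + snd x * snd y <= norm x * norm y.
Proof.
  pose proof (norm_ge_0 x) as hx. pose proof (norm_ge_0 y) as hy.
  pose proof (norm_sqr x) as hx2. pose proof (norm_sqr y) as hy2.
  set (a := norm x) in *. set (b := norm y) in *.
  destruct x as [x1 x2], y as [y1 y2]; simpl in *.
  apply Rnot_lt_le. intros hlt.
  assert (0 <= a * b) by nra.
  assert ((a * b) * (a * b) < (x1 * y1 + x2 * y2) * (x1 * y1 + x2 * y2)) by nra.
  assert (0 <= (x1 * y2 - x2 * y1) ^ 2) by apply pow2_ge_0.
  replace ((a * b) * (a * b)) with ((a * (a * 1)) * (b * (b * 1))) in * by ring.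
  rewrite hx2, hy2 in *. nra.
Qed.

(** * Functions close to a decreasing one *)

Lemma last_crossing (z : R -> R) (u v a : R) :
  u <= v -> (forall t, u <= t <= v -> continuous z t) ->
  z u <= a -> a < z v ->
  exists s, u <= s < v /\ z s = a /\ forall t, s < t <= v -> a < z t.
Proof.
  intros huv hc hu hv.
  destruct (completeness (fun t => u <= t <= v /\ z t <= a)) as [s [hub hlub]].
  - exists v. intros t [ht _]. lra.
  - exists u. split; lra.
  - assert (hus : u <= s) by (apply hub; split; lra).
    assert (hsv : s <= v) by (apply hlub; intros t [ht _]; lra).
    assert (hafter : forall t, s < t <= v -> a < z t).
    { intros t ht. destruct (Rlt_le_dec a (z t)) as [h | h]; [exact h |].
      assert (t <= s) by (apply hub; split; lra). lra. }
    assert (hcs : continuous z s) by (apply hc; lra).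
    assert (hle : z s <= a).
    { destruct (Rle_lt_dec (z s) a) as [h | h]; [exact h |].
      destruct (hcs (fun y => a < y) (open_gt a (z s) h)) as [d hd].
      assert (s <= s - d).
      { apply hlub. intros t [ht hta].
        destruct (Rle_lt_dec t (s - d)) as [h' | h']; [exact h' |].
        assert (t <= s) by (apply hub; split; lra).
        assert (a < z t); [|lra]. apply hd.
        apply Rabs_def1; unfold minus, plus, opp; simpl; lra. }
      destruct d as [d hd0]; simpl in *; lra. }
    assert (hsv' : s < v) by (destruct (Req_dec s v) as [-> |]; lra).
    assert (hge : a <= z s).
    { destruct (Rle_lt_dec a (z s)) as [h | h]; [exact h |].
      destruct (hcs (fun y => y < a) (open_lt a (z s) h)) as [d hd].
      pose (t := Rmin v (s + d / 2)).
      assert (hd0 := cond_pos d).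
      assert (ht : s < t <= v /\ t <= s + d / 2).
      { unfold t, Rmin; destruct (Rle_dec v (s + d / 2)); lra. }
      assert (z t < a).
      { apply hd. apply Rabs_def1; unfold minus, plus, opp; simpl; lra. }
      assert (a < z t) by (apply hafter; lra). lra. }
    exists s. repeat split; try lra. exact hafter.
Qed.

(** The last crossing for the reversed and negated function. *)
Lemma first_crossing (z : R -> R) (u v b : R) :
  u <= v -> (forall t, u <= t <= v -> continuous z t) ->
  z u < b -> b <= z v ->
  exists s, u < s <= v /\ z s = b /\ forall t, u <= t < s -> z t < b.
Proof.
  intros huv hc hu hv.
  destruct (last_crossing (fun t => - z (- t)) (- v) (- u) (- b)) as [s [hs [hz h]]].
  - lra.
  - intros t ht. apply (continuous_opp (V := R_NormedModule) (fun t => z (- t))).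
    apply (continuous_comp Ropp z).
    + apply (continuous_opp (V := R_NormedModule) (fun t : R => t)), continuous_id.
    + apply hc; lra.
  - rewrite Ropp_involutive; lra.
  - rewrite Ropp_involutive; lra.
  - exists (- s). repeat split; try lra.
    intros t ht. specialize (h (- t)). rewrite Ropp_involutive in h.
    assert (- s < t -> False) by lra. lra.
Qed.

Lemma decrease_along (W : R -> R) (u v c : R) :
  u <= v ->
  (forall t, u <= t <= v -> exists l, is_derive W t l /\ l <= - c) ->
  W v <= W u - c * (v - u).
Proof.
  intros huv h.
  destruct (MVT_gen W u v (Derive W)) as [t [ht heq]].
  - intros t ht. rewrite Rmin_left, Rmax_right in ht by lra.
    destruct (h t) as [l [hl _]]; [lra |]. apply Derive_correct. now exists l.
  - intros t ht. rewrite Rmin_left, Rmax_right in ht by lra.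
    destruct (h t) as [l [hl _]]; [lra |].
    apply continuity_pt_filterlim, (ex_derive_continuous W t). now exists l.
  - rewrite Rmin_left, Rmax_right in ht by lra.
    destruct (h t) as [l [hl hlc]]; [lra |].
    apply is_derive_unique in hl. rewrite hl in heq. nra.
Qed.

(** Only [W] need be differentiable and decreasing; [z] is the quantity to be
    controlled, and it may oscillate with amplitude [eta] around [W]. *)
Definition approx_lyapunov (z W : R -> R) (c eta t : R) : Prop :=
  Rabs (W t - z t) <= eta /\ exists l, is_derive W t l /\ l <= - c.

(** Between the last passage of [z] at [a] and its first passage at [b], the
    function [W] would have to grow by at least [b - a - 2 eta]. *)
Lemma barrier (z W : R -> R) (u v a b c eta : R) :
  u <= v -> 0 <= c -> a < b -> 2 * eta < b - a ->
  (forall t, u <= t <= v -> continuous z t) ->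
  (forall t, u <= t <= v -> a <= z t <= b -> approx_lyapunov z W c eta t) ->
  z u <= a -> z v < b.
Proof.
  intros huv hc hab heta hz hW hu.
  destruct (Rlt_le_dec (z v) b) as [h | hv]; [exact h | exfalso].
  destruct (first_crossing z u v b) as [t [ht [hzt hbt]]]; try lra; try assumption.
  destruct (last_crossing z u t a) as [s [hs [hzs has]]]; try lra.
  { intros y hy; apply hz; lra. }
  assert (hin : forall y, s <= y <= t -> approx_lyapunov z W c eta y).
  { intros y hy. apply hW; [lra |].
    destruct (Req_dec y s) as [-> |]; [lra |].
    destruct (Req_dec y t) as [-> |]; [lra |].
    split; [apply Rlt_le, has | apply Rlt_le, hbt]; lra. }
  assert (hdec : W t <= W s - c * (t - s)).
  { apply decrease_along; [lra | intros y hy; apply hin, hy]. }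
  destruct (hin s) as [h1 _]; [lra |]. destruct (hin t) as [h2 _]; [lra |].
  apply Rabs_le_between in h1, h2. nra.
Qed.

(** Otherwise [z] stays in the band, and [W] falls by more than the width of the
    band allows. *)
Lemma entry (z W : R -> R) (u v a b c eta : R) :
  u <= v -> b - a + 2 * eta < c * (v - u) ->
  (forall t, u <= t <= v -> a <= z t <= b -> approx_lyapunov z W c eta t) ->
  (forall t, u <= t <= v -> z t <= b) ->
  exists t, u <= t <= v /\ z t <= a.
Proof.
  intros huv hlong hW hb.
  destruct (Classical_Prop.classic (exists t, u <= t <= v /\ z t <= a)) as [h | hno];
    [exact h | exfalso].
  assert (ha : forall t, u <= t <= v -> a < z t).
  { intros t ht. destruct (Rlt_le_dec a (z t)) as [h | h]; [exact h |].
    destruct hno. now exists t. }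
  assert (hin : forall t, u <= t <= v -> approx_lyapunov z W c eta t).
  { intros t ht. apply hW; [exact ht |]. split; [apply Rlt_le |]; auto. }
  assert (hdec : W v <= W u - c * (v - u)).
  { apply decrease_along; [exact huv | intros t ht; apply hin, ht]. }
  destruct (hin u) as [h1 _]; [lra |]. destruct (hin v) as [h2 _]; [lra |].
  assert (a < z v) by (apply ha; lra). assert (z u <= b) by (apply hb; lra).
  apply Rabs_le_between in h1, h2. nra.
Qed.

(** * Averaging by near-identity correction *)

(** The variables of the polynomials.  [Gen i n] is the [n]-th derivative of
    [F i] at the current energy. *)
Inductive atom : Set :=
  | Forward | Lateral
  | Cosine | Sine
  | Gen (i : index) (n : nat)
  | ForwardDrift | LateralDrift.

Inductive expr : Set :=
  | Cst (a : R) | At (a : atom) | Add (u v : expr) | Mul (u v : expr).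

(** Polynomials are kept as syntax so that the three parts of a time derivative
    are syntactic derivations, differentiability and boundedness are each proved
    once by induction, and the corrector equations are ring identities. *)
Fixpoint eval (env : atom -> R) (u : expr) : R :=
  match u with
  | Cst a => a
  | At a => env a
  | Add u v => eval env u + eval env v
  | Mul u v => eval env u * eval env v
  end.

Fixpoint deriv (d : atom -> expr) (u : expr) : expr :=
  match u with
  | Cst _ => Cst 0
  | At a => d a
  | Add u v => Add (deriv d u) (deriv d v)
  | Mul u v => Add (Mul (deriv d u) v) (Mul u (deriv d v))
  end.

(** Number of derivatives of the generators involved.  The drifts count as 2
    because the velocity of the target is bounded but need not be differentiable: an
    expression of order at most 1 may be differentiated along trajectories, one of
    order at most 2 is bounded. *)
Definition atom_order (a : atom) : nat :=
  match a with
  | Gen _ n => n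
  | ForwardDrift | LateralDrift => 2
  | _ => 0
  end.

Fixpoint order (u : expr) : nat :=
  match u with
  | Cst _ => 0
  | At a => atom_order a
  | Add u v | Mul u v => Nat.max (order u) (order v)
  end.

Declare Scope expr_scope.
Delimit Scope expr_scope with expr.
Bind Scope expr_scope with expr.
Infix "+" := Add : expr_scope.
Infix "*" := Mul : expr_scope.
Notation "u - v" := (Add u (Mul (Cst (-1)) v)) : expr_scope.

Lemma eval_bounded (B : R) (u : expr) :
  (order u <= 2)%nat ->
  exists M, 0 < M /\ forall env,
    (forall a, (atom_order a <= 2)%nat -> Rabs (env a) <= B) ->
    Rabs (eval env u) <= M.
Proof.
  induction u as [x | a | u IHu v IHv | u IHu v IHv]; simpl; intros hu.
  - exists (Rabs x + 1). split; [pose proof (Rabs_pos x); lra |]. intros; lra.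
  - exists (Rabs B + 1). split; [pose proof (Rabs_pos B); lra |].
    intros env h. specialize (h a hu). pose proof (Rle_abs B). lra.
  - destruct IHu as [M [hM hu']]; [lia |]. destruct IHv as [N [hN hv']]; [lia |].
    exists (M + N). split; [lra |]. intros env h.
    pose proof (Rabs_triang (eval env u) (eval env v)).
    specialize (hu' env h). specialize (hv' env h). lra.
  - destruct IHu as [M [hM hu']]; [lia |]. destruct IHv as [N [hN hv']]; [lia |].
    exists (M * N). split; [nra |]. intros env h. rewrite Rabs_mult.
    apply Rmult_le_compat; auto using Rabs_pos.
Qed.

Lemma is_derive_div_const (h : R -> R) (t l c : R) :
  is_derive h t l -> is_derive (fun s => h s / c) t (l / c).
Proof.
  intros hh. unfold Rdiv. rewrite (Rmult_comm l).
  apply (is_derive_ext (fun s => / c * h s)); [intros; apply Rmult_comm |].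
  now apply is_derive_scal.
Qed.

Section Averaging.

Context (kappa q g : R).

Definition Fwd := At Forward.
Definition Lat := At Lateral.
Definition Cs := At Cosine.
Definition Sn := At Sine.
Definition gen (i : index) := At (Gen i 0).
Definition dgen (i : index) := At (Gen i 1).

Definition cost : expr := (Cst kappa * (Fwd * Fwd + Lat * Lat))%expr.
Definition input : expr := (gen Defs.one * Cs + gen Defs.two * Sn)%expr.

(** The derivations [D0], [D1], [D2], with coefficients [omega], [sqrt omega] and 1
    in the time derivative. *)
Definition d_phase (a : atom) : expr :=
  match a with
  | Forward => Cst q * Lat
  | Lateral => Cst (- q) * Fwd
  | Cosine => Cst (-1) * Sn
  | Sine => Cs
  | _ => Cst 0
  end%expr.

Definition d_input (a : atom) : expr :=
  match a with
  | Forward => Cst g * input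
  | Gen i n => At (Gen i (n + 1)) * (Cst (2 * kappa * g) * (Fwd * input))
  | _ => Cst 0
  end%expr.

Definition d_drift (a : atom) : expr :=
  match a with
  | Forward => At ForwardDrift
  | Lateral => At LateralDrift
  | Gen i n =>
      At (Gen i (n + 1)) *
        (Cst (2 * kappa) * (Fwd * At ForwardDrift + Lat * At LateralDrift))
  | _ => Cst 0
  end%expr.

Lemma order_deriv (d : atom -> expr) (u : expr) :
  (forall a, (atom_order a <= 1)%nat -> (order (d a) <= 2)%nat) ->
  (order u <= 1)%nat -> (order (deriv d u) <= 2)%nat.
Proof.
  intros hd. induction u as [x | a | u IHu v IHv | u IHu v IHv]; simpl; intros hu.
  - lia.
  - auto.
  - specialize (IHu ltac:(lia)). specialize (IHv ltac:(lia)). lia.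
  - specialize (IHu ltac:(lia)). specialize (IHv ltac:(lia)). lia.
Qed.

Lemma is_derive_eval (omega : R) (env : R -> atom -> R) (t : R) (u : expr) :
  (forall a, (atom_order a <= 1)%nat ->
    is_derive (fun s => env s a) t
      (omega * eval (env t) (d_phase a) + sqrt omega * eval (env t) (d_input a)
       + eval (env t) (d_drift a))) ->
  (order u <= 1)%nat ->
  is_derive (fun s => eval (env s) u) t
    (omega * eval (env t) (deriv d_phase u) + sqrt omega * eval (env t) (deriv d_input u)
     + eval (env t) (deriv d_drift u)).
Proof.
  intros henv. induction u as [x | a | u IHu v IHv | u IHu v IHv]; simpl; intros hu.
  - replace (_ + _) with 0 by ring. apply (is_derive_const (V := R_NormedModule)).
  - auto.
  - specialize (IHu ltac:(lia)). specialize (IHv ltac:(lia)).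
    evar_last; [apply (is_derive_plus _ _ _ _ _ IHu IHv) |].
    unfold plus; simpl; ring.
  - specialize (IHu ltac:(lia)). specialize (IHv ltac:(lia)).
    evar_last; [apply (is_derive_mult _ _ _ _ _ IHu IHv) |].
    + intros; apply Rmult_comm.
    + unfold plus, mult; simpl; ring.
Qed.

Definition detuning : R := 1 - q ^ 2.

(** Found by integrating [cos tau cos (q tau)] and the like: [1 / detuning] is the
    product of the inverses of the two frequencies [1 + q] and [1 - q]. *)
Definition corrector1 : expr :=
  (Cst (2 * kappa * g / detuning) *
     (gen Defs.one * (Sn * Fwd + Cst q * (Cs * Lat))
      + gen Defs.two * (Cst q * (Sn * Lat) - Cs * Fwd)))%expr.

(** Double angles.  [Cs2], [Sn2] have [D0]-frequency 2 and [Quad], [Cross] have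
    [D0]-frequency [2 q], so their products have frequencies [2 + 2 q] and [2 - 2 q]. *)
Definition Cs2 : expr := (Cs * Cs - Sn * Sn)%expr.
Definition Sn2 : expr := (Cst 2 * (Sn * Cs))%expr.
Definition Quad : expr := (Fwd * Fwd - Lat * Lat)%expr.
Definition Cross : expr := (Cst 2 * (Fwd * Lat))%expr.

Definition half_diff : expr :=
  (Cst (1 / 2) * (gen Defs.one * gen Defs.one - gen Defs.two * gen Defs.two))%expr.
Definition prod_gen : expr := (gen Defs.one * gen Defs.two)%expr.
Definition dhalf_diff : expr := (gen Defs.one * dgen Defs.one - gen Defs.two * dgen Defs.two)%expr.
Definition dprod_gen : expr := (gen Defs.one * dgen Defs.two + gen Defs.two * dgen Defs.one)%expr.
Definition dhalf_sum : expr := (gen Defs.one * dgen Defs.one + gen Defs.two * dgen Defs.two)%expr.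

(** [D1 corrector1] is expanded in double angles and integrated term by term.  A
    product of a [Cs2] or [Sn2] with a [Quad] or [Cross] is integrated with
    undetermined coefficients, which gives those over [detuning]. *)
Definition corrector2 : expr :=
  (Cst (2 * kappa * g ^ 2 / detuning) *
     (Cst (- / 2) * (Cs2 * (half_diff + Cst (1 / 2) * (cost * dhalf_diff)))
      + Cst (- / 2) * (Sn2 * (prod_gen + Cst (1 / 2) * (cost * dprod_gen)))
      + Cst (- kappa / (4 * q)) * Cross
      + Cst (kappa / 4) * (dhalf_sum * Quad)
      + Cst (kappa / 2) *
          (dhalf_diff * (Cst (- (1 + q ^ 2) / (2 * detuning)) * (Quad * Cs2)
                         + Cst (q / detuning) * (Cross * Sn2))
           + dprod_gen * (Cst (- (1 + q ^ 2) / (2 * detuning)) * (Quad * Sn2)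
                          - Cst (q / detuning) * (Cross * Cs2)))))%expr.

Lemma corrector1_phase (env : atom -> R) : detuning <> 0 ->
  eval env (deriv d_phase corrector1) = eval env (deriv d_input cost).
Proof. intros hm. simpl. unfold detuning in *. field. exact hm. Qed.

(** The mean subtracted here is the effect of the Lie brackets of the generators:
    all terms of [D1 corrector1] oscillate except the one carrying the Wronskian. *)
Lemma corrector2_phase (env : atom -> R) :
  detuning <> 0 -> q <> 0 ->
  env Cosine * env Cosine + env Sine * env Sine = 1 ->
  env (Gen Defs.two 0) * env (Gen Defs.one 1) - env (Gen Defs.one 0) * env (Gen Defs.two 1) = 1 ->
  eval env (deriv d_phase corrector2) =
  eval env (deriv d_input corrector1) - kappa * g ^ 2 / detuning * eval env cost.
Proof.
  intros hm hq hcs hw. simpl. unfold detuning in *.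
  generalize dependent (env (Gen Defs.one 0)). generalize dependent (env (Gen Defs.two 0)).
  generalize dependent (env (Gen Defs.one 1)). generalize dependent (env (Gen Defs.two 1)).
  generalize dependent (env Cosine). generalize dependent (env Sine).
  generalize (env Forward) (env Lateral). intros p r s c hcs f2' f1' f2 f1 hw.
  assert (hc : c * c = 1 - s * s) by lra.
  assert (hw' : f2 * f1' = 1 + f1 * f2') by lra.
  field [hc hw'].
  split; assumption.
Qed.

Definition corrected_cost (omega : R) (env : atom -> R) : R :=
  eval env cost - eval env corrector1 / sqrt omega + eval env corrector2 / omega.

(** The terms of order [omega] and [sqrt omega] in the derivative of
    [corrected_cost] cancel, and what is left beyond the mean and the drift of the
    cost is at most [1 / sqrt omega] times bounded expressions. *)
Lemma averaged_decrease (B : R) :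
  detuning <> 0 -> q <> 0 ->
  exists K, 0 < K /\ forall omega env t,
    1 <= omega ->
    (forall a, (atom_order a <= 2)%nat -> Rabs (env t a) <= B) ->
    (forall a, (atom_order a <= 1)%nat ->
      is_derive (fun s => env s a) t
        (omega * eval (env t) (d_phase a) + sqrt omega * eval (env t) (d_input a)
         + eval (env t) (d_drift a))) ->
    env t Cosine * env t Cosine + env t Sine * env t Sine = 1 ->
    env t (Gen Defs.two 0) * env t (Gen Defs.one 1)
      - env t (Gen Defs.one 0) * env t (Gen Defs.two 1) = 1 ->
    Rabs (corrected_cost omega (env t) - eval (env t) cost) <= K / sqrt omega /\
    exists l,
      is_derive (fun s => corrected_cost omega (env s)) t l /\
      l <= - (kappa * g ^ 2 / detuning * eval (env t) cost)
           + eval (env t) (deriv d_drift cost) + K / sqrt omega.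
Proof.
  intros hm hq.
  assert (hi : forall a, (atom_order a <= 1)%nat -> (order (d_input a) <= 2)%nat).
  { intros [ | | | | i n | | ]; simpl; lia. }
  assert (hd : forall a, (atom_order a <= 1)%nat -> (order (d_drift a) <= 2)%nat).
  { intros [ | | | | i n | | ]; simpl; lia. }
  assert (h1 : (order corrector1 <= 1)%nat) by (simpl; lia).
  assert (h2 : (order corrector2 <= 1)%nat) by (simpl; lia).
  destruct (eval_bounded B corrector1) as [K1 [hK1 b1]]; [lia |].
  destruct (eval_bounded B corrector2) as [K2 [hK2 b2]]; [lia |].
  destruct (eval_bounded B (deriv d_drift corrector1)) as [K3 [hK3 b3]];
    [now apply order_deriv |].
  destruct (eval_bounded B (deriv d_input corrector2)) as [K4 [hK4 b4]];
    [now apply order_deriv |].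
  destruct (eval_bounded B (deriv d_drift corrector2)) as [K5 [hK5 b5]];
    [now apply order_deriv |].
  exists (K1 + K2 + K3 + K4 + K5). split; [lra |].
  intros omega env t ho hB henv hcs hw.
  assert (hs : 1 <= sqrt omega) by (rewrite <- sqrt_1; apply sqrt_le_1; lra).
  assert (hss : sqrt omega * sqrt omega = omega) by (apply sqrt_sqrt; lra).
  specialize (b1 _ hB). specialize (b2 _ hB). specialize (b3 _ hB).
  specialize (b4 _ hB). specialize (b5 _ hB).
  pose proof (is_derive_eval omega env t cost henv ltac:(simpl; lia)) as e0.
  pose proof (is_derive_eval omega env t corrector1 henv h1) as e1.
  pose proof (is_derive_eval omega env t corrector2 henv h2) as e2.
  rewrite (corrector1_phase (env t) hm) in e1.
  rewrite (corrector2_phase (env t) hm hq hcs hw) in e2.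
  replace (eval (env t) (deriv d_phase cost)) with 0 in e0 by (simpl; ring).
  unfold corrected_cost.
  set (G1 := eval (env t) corrector1) in *. set (G2 := eval (env t) corrector2) in *.
  set (z := eval (env t) cost) in *.
  set (z1 := eval (env t) (deriv d_input cost)) in *.
  set (z2 := eval (env t) (deriv d_drift cost)) in *.
  set (D3 := eval (env t) (deriv d_drift corrector1)) in *.
  set (D4 := eval (env t) (deriv d_input corrector2)) in *.
  set (D5 := eval (env t) (deriv d_drift corrector2)) in *.
  set (S1 := eval (env t) (deriv d_input corrector1)) in *.
  set (k := kappa * g ^ 2 / detuning) in *.
  set (i := / sqrt omega).
  assert (hi0 : 0 < i <= 1).
  { split; [apply Rinv_0_lt_compat; lra |]. rewrite <- Rinv_1. apply Rinv_le_contravar; lra. }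
  assert (hio : / omega = i * i) by (unfold i; now rewrite <- Rinv_mult, hss).
  apply Rabs_le_between in b1, b2, b3, b4, b5.
  unfold Rdiv at 1 2 3. rewrite hio. fold i.
  assert (hii : i * i <= i) by nra.
  split.
  - apply Rabs_le. split; nra.
  - eexists. split.
    + apply (is_derive_plus (V := R_NormedModule)).
      * apply (is_derive_minus (V := R_NormedModule)); [exact e0 |].
        apply is_derive_div_const, e1.
      * apply is_derive_div_const, e2.
    + unfold minus, plus, opp; simpl. unfold Rdiv at 1 2.
      rewrite hio. fold i.
      assert (hso : sqrt omega * i = 1) by (unfold i; field; lra).
      assert (hoi : omega * i = sqrt omega) by (unfold i; field_simplify_eq; lra).
      set (s := sqrt omega) in *.
      replace (_ + _) with
        (- (k * z) + z2 + i * (D4 - D3 + i * D5)).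
      * unfold Rdiv; fold i.
        assert (D4 - D3 + i * D5 <= K1 + K2 + K3 + K4 + K5) by nra.
        assert (i * (D4 - D3 + i * D5) <= i * (K1 + K2 + K3 + K4 + K5))
          by (apply Rmult_le_compat_l; lra).
        lra.
      * transitivity (s * z1 + z2 - ((omega * i) * z1 + (s * i) * S1 + i * D3)
          + ((omega * i) * i * (S1 - k * z) + (s * i) * i * D4 + i * i * D5)).
        { rewrite hoi, hso. ring_simplify.
          replace (s * i * S1) with S1 by (rewrite hso; ring).
          replace (s * i * k * z) with (k * z) by (rewrite hso; ring). ring. }
        ring.
Qed.
End Averaging.

(** * Global solutions of bounded Lipschitz systems *)

Lemma minus_plus_cancel {G : AbelianGroup} (a b c : G) :
  minus (plus a b) (plus a c) = minus b c.
Proof.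
  unfold minus. rewrite opp_plus, (plus_comm a b), <- plus_assoc.
  rewrite (plus_assoc a (opp a)). rewrite (plus_opp_r a), plus_zero_l. reflexivity.
Qed.

Lemma plus_minus_cancel {G : AbelianGroup} (a b : G) : minus (plus a b) a = b.
Proof.
  unfold minus. rewrite (plus_comm a b), <- plus_assoc.
  exact (eq_trans (f_equal (plus b) (plus_opp_r a)) (plus_zero_r b)).
Qed.

Lemma minus_zero_eq {G : AbelianGroup} (a b : G) : minus a b = zero -> a = b.
Proof.
  intros h. apply (plus_reg_r (opp b)). exact (eq_trans h (eq_sym (plus_opp_r b))).
Qed.

Lemma norm_minus_triangle {V : NormedModule R_AbsRing} (x y z : V) :
  norm (minus x z) <= norm (minus x y) + norm (minus y z).
Proof. rewrite (minus_trans y x z). apply (norm_triangle (minus x y) (minus y z)). Qed.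

Lemma continuous_Rmax (a x : R) : continuous (fun z => Rmax a z) x.
Proof.
  apply (continuous_ext (fun z => (a + z + Rabs (a - z)) / 2)).
  - intros z. unfold Rmax, Rabs. destruct (Rle_dec a z), (Rcase_abs (a - z)); lra.
  - apply continuity_pt_filterlim. unfold Rdiv. reg.
Qed.

Section Picard.

Context {E : CompleteNormedModule R_AbsRing}.
Context (f : R -> E -> E) (L M t0 : R) (x0 : E).
Hypothesis hL : 0 < L.
Hypothesis hlip : forall t x y, norm (minus (f t x) (f t y)) <= L * norm (minus x y).
Hypothesis hbound : forall t x, norm (f t x) <= M.
Hypothesis hcont : forall x t, continuous (fun s => f s x) t.

Lemma continuous_along (x : R -> E) (t : R) :
  continuous x t -> continuous (fun s => f s (x s)) t.
Proof.
  intros hx.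
  apply (proj2 (filterlim_locally_ball_norm (fun s => f s (x s)) _)). intros eps.
  assert (h1 : locally t (fun s => norm (minus (f s (x t)) (f t (x t))) < eps / 2)).
  { refine (proj1 (filterlim_locally_ball_norm (fun s => f s (x t)) (f t (x t)))
      (hcont (x t) t) (mkposreal (eps / 2) _)). pose proof (cond_pos eps); lra. }
  assert (h2 : locally t (fun s => norm (minus (x s) (x t)) < eps / 2 / L)).
  { refine (proj1 (filterlim_locally_ball_norm x (x t)) hx (mkposreal (eps / 2 / L) _)).
    pose proof (cond_pos eps). apply Rdiv_lt_0_compat; lra. }
  generalize (filter_and _ _ h1 h2). apply filter_imp. intros s [a b].
  unfold ball_norm.
  rewrite (minus_trans (f s (x t))).
  pose proof (norm_triangle (minus (f s (x s)) (f s (x t)))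
                (minus (f s (x t)) (f t (x t)))) as htri.
  eapply Rle_lt_trans; [exact htri |].
  specialize (hlip s (x s) (x t)).
  assert (L * norm (minus (x s) (x t)) < L * (eps / 2 / L)) by (apply Rmult_lt_compat_l; auto).
  replace (L * (eps / 2 / L)) with (eps / 2) in H by (field; lra).
  lra.
Qed.

Definition picard_step (x : R -> E) (t : R) : E :=
  plus x0 (RInt (fun s => f s (x s)) t0 t).

Fixpoint picard (n : nat) : R -> E :=
  match n with
  | 0 => fun _ => x0
  | S n => picard_step (picard n)
  end.

Lemma ex_RInt_along (x : R -> E) (a b : R) :
  (forall t, continuous x t) -> ex_RInt (fun s => f s (x s)) a b.
Proof.
  intros hx. apply ex_RInt_continuous. intros t _. now apply continuous_along.
Qed.

Lemma is_derive_picard_step (x : R -> E) (t : R) :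
  (forall t, continuous x t) ->
  is_derive (picard_step x) t (f t (x t)).
Proof.
  intros hx. unfold picard_step.
  rewrite <- (plus_zero_l (f t (x t))).
  apply (is_derive_plus (V := E) (fun _ => x0) (fun t => RInt (fun s => f s (x s)) t0 t)).
  - apply (is_derive_const (V := E)).
  - apply (is_derive_RInt (V := E) (fun s => f s (x s)) _ t0).
    + apply filter_forall. intros b. apply RInt_correct, ex_RInt_along, hx.
    + now apply continuous_along.
Qed.

Lemma picard_continuous (n : nat) (t : R) : continuous (picard n) t.
Proof.
  revert t. induction n as [| n IH]; intros t; [apply continuous_const |].
  apply (ex_derive_continuous (V := E) (picard (S n))). eexists. now apply is_derive_picard_step.
Qed.

(** Weighting by [exp (2 L (t - t0))] makes the step a contraction with ratio 1/2
    on the whole half-line, so that no gluing of short intervals is needed. *)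
Lemma picard_step_contracts (x y : R -> E) (D t1 : R) :
  t0 <= t1 ->
  (forall t, continuous x t) -> (forall t, continuous y t) ->
  (forall t, t0 <= t <= t1 -> norm (minus (x t) (y t)) <= D * exp (2 * L * (t - t0))) ->
  0 <= D ->
  norm (minus (picard_step x t1) (picard_step y t1)) <= D / 2 * exp (2 * L * (t1 - t0)).
Proof.
  intros ht hx hy hD hD0.
  unfold picard_step.
  replace (minus _ _) with
    (minus (RInt (fun s => f s (x s)) t0 t1) (RInt (fun s => f s (y s)) t0 t1)).
  2:{ symmetry. apply (minus_plus_cancel (G := E)). }
  eapply Rle_trans.
  - eapply (norm_RInt_le _ (fun s => L * (D * exp (2 * L * (s - t0)))) t0 t1); [exact ht | | |].
    + intros s hs. eapply Rle_trans; [apply hlip |].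
      apply Rmult_le_compat_l; [lra | now apply hD].
    + apply (is_RInt_minus (V := E)); apply RInt_correct, ex_RInt_along; assumption.
    + apply (is_RInt_derive (fun s => D / 2 * exp (2 * L * (s - t0)))).
      * intros s _. auto_derive; [trivial |]. unfold Rminus, Rdiv. field.
      * intros s _. apply (ex_derive_continuous (V := R_NormedModule)). auto_derive. trivial.
  - unfold minus, plus, opp; simpl.
    replace (2 * L * (t0 - t0)) with 0 by ring. rewrite exp_0. lra.
Qed.

Lemma bound_nonneg : 0 <= M.
Proof. exact (Rle_trans _ _ _ (norm_ge_0 (f t0 x0)) (hbound t0 x0)). Qed.

Lemma picard_increment (n : nat) (t : R) : t0 <= t ->
  norm (minus (picard (S n) t) (picard n t))
    <= M / (2 * L) * (/ 2) ^ n * exp (2 * L * (t - t0)).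
Proof.
  pose proof bound_nonneg as hM.
  assert (hML : 0 <= M / (2 * L)) by (apply Rle_mult_inv_pos; lra).
  revert t. induction n as [| n IH]; intros t ht.
  - simpl. unfold picard_step.
    replace (minus _ _) with (RInt (fun s => f s x0) t0 t).
    2:{ symmetry. apply (plus_minus_cancel (G := E)). }
    eapply Rle_trans.
    + apply (norm_RInt_le_const (fun s => f s x0) t0 t _ M ht); [intros; apply hbound |].
      apply RInt_correct, (ex_RInt_along (fun _ => x0)). intros; apply continuous_const.
    + pose proof (exp_ineq1_le (2 * L * (t - t0))).
      replace ((t - t0) * M) with (M / (2 * L) * (2 * L * (t - t0))) by (field; lra).
      rewrite Rmult_1_r. apply Rmult_le_compat_l; lra.
  - change (picard (S (S n)) t) with (picard_step (picard (S n)) t).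
    change (picard (S n) t) with (picard_step (picard n) t).
    eapply Rle_trans.
    + apply picard_step_contracts with (D := M / (2 * L) * (/ 2) ^ n); auto using picard_continuous.
      * intros s hs. apply IH. lra.
      * apply Rmult_le_pos; [lra | apply pow_le; lra].
    + simpl. right. field. lra.
Qed.

Lemma picard_tail (n k : nat) (t : R) : t0 <= t ->
  norm (minus (picard (n + k) t) (picard n t))
    <= M / L * (/ 2) ^ n * exp (2 * L * (t - t0)).
Proof.
  intros ht.
  pose proof bound_nonneg as hM.
  assert (hML : 0 <= M / (2 * L)) by (apply Rle_mult_inv_pos; lra).
  set (c := M / (2 * L) * exp (2 * L * (t - t0))).
  assert (hc : 0 <= c) by (apply Rmult_le_pos; [lra | apply Rlt_le, exp_pos]).
  assert (hn : 0 <= (/ 2) ^ n) by (apply pow_le; lra).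
  assert (hk : norm (minus (picard (n + k) t) (picard n t))
                 <= 2 * c * (/ 2) ^ n * (1 - (/ 2) ^ k)).
  { induction k as [| k IH].
    - rewrite Nat.add_0_r, minus_eq_zero.
      replace (norm _) with 0 by (symmetry; apply (norm_zero (V := E))). simpl; lra.
    - replace (n + S k)%nat with (S (n + k)) by lia.
      rewrite (minus_trans (picard (n + k) t)).
      pose proof (norm_triangle (minus (picard (S (n + k)) t) (picard (n + k) t))
                    (minus (picard (n + k) t) (picard n t))) as htri.
      eapply Rle_trans; [exact htri |].
      pose proof (picard_increment (n + k) t ht) as hinc.
      rewrite pow_add in hinc. simpl pow.
      replace (2 * c * (/ 2) ^ n * (1 - / 2 * (/ 2) ^ k))
        with (c * (/ 2) ^ n * (/ 2) ^ k + 2 * c * (/ 2) ^ n * (1 - (/ 2) ^ k)) by lra.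
      apply Rplus_le_compat; [| exact IH].
      eapply Rle_trans; [exact hinc |]. right. unfold c. ring. }
  eapply Rle_trans; [exact hk |].
  replace (M / L * (/ 2) ^ n * exp (2 * L * (t - t0))) with (2 * c * (/ 2) ^ n)
    by (unfold c; field; lra).
  assert (0 <= (/ 2) ^ k) by (apply pow_le; lra).
  assert (0 <= 2 * c * (/ 2) ^ n) by (apply Rmult_le_pos; lra). nra.
Qed.

Lemma geometric_small (c eps : R) : 0 < eps -> exists n, c * (/ 2) ^ n < eps.
Proof.
  intros he. pose proof (Rabs_pos c).
  destruct (pow_lt_1_zero (/ 2) ltac:(rewrite Rabs_pos_eq; lra) (eps / (Rabs c + 1)))
    as [n hn]; [apply Rdiv_lt_0_compat; lra |].
  exists n. specialize (hn n (Nat.le_refl n)).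
  assert (hp : 0 < (/ 2) ^ n) by (apply pow_lt; lra).
  rewrite Rabs_pos_eq in hn by lra.
  apply Rlt_div_r in hn; [| lra]. pose proof (Rle_abs c). nra.
Qed.

Lemma picard_converges (t : R) : t0 <= t ->
  exists y, filterlim (fun n => picard n t) eventually (locally y).
Proof.
  intros ht.
  apply (proj1 (filterlim_locally_cauchy (U := E) (fun n => picard n t))). intros eps.
  set (c := M / L * exp (2 * L * (t - t0))).
  destruct (geometric_small c (eps / 2)) as [n hn]; [pose proof (cond_pos eps); lra |].
  exists (fun k => (n <= k)%nat). split; [now exists n |].
  intros i j hi hj.
  apply (norm_compat1 (V := E)).
  rewrite (minus_trans (picard n t)).
  pose proof (norm_triangle (minus (picard j t) (picard n t))
                (minus (picard n t) (picard i t))) as htri.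
  eapply Rle_lt_trans; [exact htri |].
  pose proof (picard_tail n (j - n) t ht) as h1.
  pose proof (picard_tail n (i - n) t ht) as h2.
  replace (n + (j - n))%nat with j in h1 by lia.
  replace (n + (i - n))%nat with i in h2 by lia.
  rewrite <- (norm_opp (V := E)), (opp_minus (G := E)) in h2.
  replace (M / L * (/ 2) ^ n * exp (2 * L * (t - t0))) with (c * (/ 2) ^ n) in *
    by (unfold c; ring).
  lra.
Qed.

(** The error bounds hold only to the right of [t0]; composing with [Rmax t0]
    makes the limit continuous on the whole line, as the integral operator expects. *)
Definition picard_limit (t : R) : E :=
  iota (fun y => filterlim (fun n => picard n (Rmax t0 t)) eventually (locally y)).

Lemma picard_limit_error (n : nat) (t : R) : t0 <= t ->
  norm (minus (picard_limit t) (picard n t))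
    <= M / L * (/ 2) ^ n * exp (2 * L * (t - t0)).
Proof.
  intros ht.
  destruct (picard_converges t ht) as [y hy].
  assert (e : picard_limit t = y).
  { unfold picard_limit. rewrite Rmax_right by exact ht. now apply iota_filterlim_locally. }
  rewrite e. apply le_epsilon. intros eps he.
  destruct (proj1 (filterlim_locally_ball_norm _ y) hy (mkposreal eps he)) as [N hN].
  specialize (hN (n + N)%nat ltac:(lia)). unfold ball_norm in hN; simpl in hN.
  rewrite <- (norm_opp (V := E)), (opp_minus (G := E)) in hN.
  rewrite (minus_trans (picard (n + N) t)).
  pose proof (norm_triangle (minus y (picard (n + N) t))
                (minus (picard (n + N) t) (picard n t))) as htri.
  pose proof (picard_tail n N t ht). eapply Rle_trans; [exact htri |]. lra.
Qed.

Lemma picard_limit_continuous (t : R) : continuous picard_limit t.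
Proof.
  apply (proj2 (filterlim_locally_ball_norm picard_limit _)). intros eps.
  pose (t' := Rmax t0 t).
  assert (ht' : t0 <= t' /\ t <= t') by (split; [apply Rmax_l | apply Rmax_r]).
  destruct (geometric_small (M / L * exp (2 * L * (t' + 1 - t0))) (eps / 3)) as [n hn].
  { pose proof (cond_pos eps); lra. }
  assert (herr : forall s, t0 <= s <= t' + 1 ->
            norm (minus (picard_limit s) (picard n s)) < eps / 3).
  { intros s hs. eapply Rle_lt_trans; [apply picard_limit_error; lra |].
    eapply Rle_lt_trans; [| exact hn].
    pose proof bound_nonneg as hM.
    rewrite Rmult_assoc, (Rmult_comm (_ ^ n)), <- Rmult_assoc.
    apply Rmult_le_compat_r; [apply pow_le; lra |].
    apply Rmult_le_compat_l; [apply Rle_mult_inv_pos; lra |].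
    destruct (Req_dec s (t' + 1)) as [-> |]; [lra |].
    apply Rlt_le, exp_increasing, Rmult_lt_compat_l; lra. }
  assert (hclamp : continuous (fun s => picard n (Rmax t0 s)) t).
  { apply (continuous_comp (fun s => Rmax t0 s) (picard n));
      [apply continuous_Rmax | apply picard_continuous]. }
  assert (hsame : forall s, picard_limit s = picard_limit (Rmax t0 s)).
  { intros s. unfold picard_limit. now rewrite (Rmax_right t0 (Rmax t0 s)) by apply Rmax_l. }
  assert (h1 : locally t (fun s =>
            norm (minus (picard n (Rmax t0 s)) (picard n t')) < eps / 3)).
  { refine (proj1 (filterlim_locally_ball_norm (fun s => picard n (Rmax t0 s)) (picard n t'))
      hclamp (mkposreal (eps / 3) _)). pose proof (cond_pos eps); lra. }
  assert (h2 : locally t (fun s => s < t + 1)) by (apply open_lt; lra).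
  generalize (filter_and _ _ h1 h2). apply filter_imp. intros s [a b].
  unfold ball_norm. rewrite (hsame s), (hsame t). fold t'.
  assert (hs : t0 <= Rmax t0 s <= t' + 1).
  { split; [apply Rmax_l |]. apply Rmax_lub; lra. }
  pose proof (herr _ hs) as e1.
  assert (e2 := herr t' ltac:(lra)).
  rewrite <- (norm_opp (V := E)), (opp_minus (G := E)) in e2.
  pose proof (norm_minus_triangle (V := E) (picard_limit (Rmax t0 s))
    (picard n (Rmax t0 s)) (picard_limit t')) as tri1.
  pose proof (norm_minus_triangle (V := E) (picard n (Rmax t0 s))
    (picard n t') (picard_limit t')) as tri2.
  eapply Rle_lt_trans; [exact tri1 |].
  eapply Rle_lt_trans; [apply Rplus_le_compat_l; exact tri2 |].
  change (norm (minus (picard_limit (Rmax t0 s)) (picard n (Rmax t0 s)))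
    + (norm (minus (picard n (Rmax t0 s)) (picard n t'))
       + norm (minus (picard n t') (picard_limit t'))) < eps).
  lra.
Qed.

Lemma picard_limit_fixed (t : R) : t0 <= t -> picard_step picard_limit t = picard_limit t.
Proof.
  intros ht.
  pose proof bound_nonneg as hM.
  apply (minus_zero_eq (G := E)).
  apply (norm_eq_zero (V := E)). apply Rle_antisym; [| apply (norm_ge_0 (V := E))].
  apply le_epsilon. intros eps he.
  set (c := M / L * exp (2 * L * (t - t0))).
  destruct (geometric_small c eps he) as [n hn].
  assert (hn0 : 0 <= M / L * (/ 2) ^ n).
  { apply Rmult_le_pos; [apply Rle_mult_inv_pos; lra | apply pow_le; lra]. }
  pose proof (picard_step_contracts picard_limit (picard n) (M / L * (/ 2) ^ n) t ht
    picard_limit_continuous (picard_continuous n)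
    (fun s hs => picard_limit_error n s (proj1 hs)) hn0) as h1.
  pose proof (picard_limit_error (S n) t ht) as h2.
  change (picard (S n) t) with (picard_step (picard n) t) in h2.
  rewrite <- (norm_opp (V := E)), (opp_minus (G := E)) in h2.
  rewrite (minus_trans (picard_step (picard n) t)).
  pose proof (norm_triangle (minus (picard_step picard_limit t) (picard_step (picard n) t))
                (minus (picard_step (picard n) t) (picard_limit t))) as tri.
  eapply Rle_trans; [exact tri |]. simpl pow in h2.
  replace (M / L * (/ 2) ^ n / 2 * exp (2 * L * (t - t0))) with (c * (/ 2) ^ n / 2) in h1
    by (unfold c; field; lra).
  replace (M / L * (/ 2 * (/ 2) ^ n) * exp (2 * L * (t - t0))) with (c * (/ 2) ^ n / 2) in h2
    by (unfold c; field; lra).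
  lra.
Qed.

(** The limit is a fixed point of the integral operator to the right of [t0]; its
    image under the operator is differentiable at [t0] also from the left. *)
Theorem picard_existence :
  exists x : R -> E, x t0 = x0 /\ forall t, t0 <= t -> is_derive x t (f t (x t)).
Proof.
  exists (picard_step picard_limit). split.
  - unfold picard_step. rewrite RInt_point. apply (plus_zero_r (G := E)).
  - intros t ht. rewrite (picard_limit_fixed t ht).
    apply is_derive_picard_step, picard_limit_continuous.
Qed.

End Picard.

(** * Radial generators *)

Lemma J_expand (kappa : R) (xi : plane) : J kappa xi = kappa * (fst xi ^ 2 + snd xi ^ 2).
Proof. unfold J. now rewrite norm_sqr. Qed.

Lemma continuous_J (kappa : R) (xi : plane) : continuous (J kappa) xi.
Proof.
  unfold J. apply (continuous_scal_r (V := R_NormedModule) kappa (fun xi => norm xi ^ 2)).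
  apply (continuous_comp (fun xi : plane => norm xi) (fun r => r ^ 2)).
  - apply filterlim_norm.
  - apply (ex_derive_continuous (V := R_NormedModule)). auto_derive. trivial.
Qed.

Lemma interior_Dtilde0 (kappa rho : R) (xi : plane) :
  0 < J kappa xi < rho -> Defs.interior (Dtilde0 kappa rho) xi.
Proof.
  intros h. unfold Defs.interior.
  assert (h1 : locally xi (fun eta => J kappa eta < rho))
    by (apply (continuous_J kappa xi (fun z => z < rho)), open_lt, h).
  assert (h2 : locally xi (fun eta => 0 < J kappa eta))
    by (apply (continuous_J kappa xi (fun z => 0 < z)), open_gt, h).
  generalize (filter_and _ _ h1 h2). apply filter_imp. intros eta [a b]. split.
  - now apply Rlt_le.
  - intros e0. rewrite e0, J_expand in b. simpl in b. unfold zero in b; simpl in b. lra.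
Qed.

(** The functions [F i o J] are radial, so their values on a half-axis carry all
    the information about [F i]. *)
Definition on_axis (s : R) : plane := (s, 0).

Lemma J_on_axis (kappa s : R) : J kappa (on_axis s) = kappa * s ^ 2.
Proof. rewrite J_expand. simpl. ring. Qed.

Lemma continuous_on_axis (s : R) : continuous on_axis s.
Proof.
  intros Q [d hd]. exists d. intros r hr. apply hd. split; [exact hr | apply ball_center].
Qed.

Lemma is_derive_on_axis (h : plane -> R) (s l : R) :
  is_partial Defs.one h (on_axis s) l -> is_derive (fun r => h (on_axis r)) s l.
Proof.
  intros hp. unfold is_partial in hp.
  apply (is_derive_ext (fun r => h (plus (on_axis s) (scal (r - s) (e Defs.one))))).
  - intros r. f_equal. unfold on_axis, plus, scal; simpl. unfold prod_plus, prod_scal; simpl.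
    unfold plus, scal; simpl; unfold mult; simpl. f_equal; ring.
  - replace l with (scal 1 l) by (unfold scal; simpl; unfold mult; simpl; ring).
    apply (is_derive_comp (fun y => h (plus (on_axis s) (scal y (e Defs.one)))) (fun r => r - s)).
    + now replace (s - s) with 0 by ring.
    + auto_derive; [trivial | ring].
Qed.

Definition C2_at (h : R -> R) (x : R) : Prop :=
  locally x (fun y => ex_derive h y /\ ex_derive (Derive h) y) /\
  continuous (Derive (Derive h)) x.

Lemma C2_at_ext (h k : R -> R) (x : R) :
  locally x (fun y => h y = k y) -> C2_at h x -> C2_at k x.
Proof.
  intros he [h1 h2].
  apply locally_locally in he.
  assert (he1 : locally x (fun y => Derive h y = Derive k y)).
  { generalize he. apply filter_imp. intros y hy. now apply Derive_ext_loc. }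
  assert (he2 : locally x (fun y => Derive (Derive h) y = Derive (Derive k) y)).
  { apply locally_locally in he1. generalize he1. apply filter_imp.
    intros y hy. now apply Derive_ext_loc. }
  split.
  - apply locally_locally in he1. generalize (filter_and _ _ h1 (filter_and _ _ he he1)).
    apply filter_imp. intros y [[a b] [c d]].
    split; [now apply (ex_derive_ext_loc h) | now apply (ex_derive_ext_loc (Derive h))].
  - now apply (continuous_ext_loc _ (Derive (Derive h))).
Qed.

(** [Derive] is a total function, so the formulas of the first and second
    derivative have to hold on a neighbourhood before they can be differentiated. *)
Lemma C2_at_comp (h k : R -> R) (x : R) :
  C2_at h (k x) -> C2_at k x -> C2_at (fun y => h (k y)) x.
Proof.
  intros [h1 h2] [k1 k2].
  assert (kx : ex_derive k x /\ ex_derive (Derive k) x) by now apply locally_singleton in k1.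
  assert (hx : ex_derive h (k x) /\ ex_derive (Derive h) (k x))
    by now apply locally_singleton in h1.
  assert (kc : continuous k x) by now apply (ex_derive_continuous k).
  assert (hk : locally x (fun y => ex_derive h (k y) /\ ex_derive (Derive h) (k y)))
    by (apply (kc _ h1)).
  assert (d1 : locally x (fun y => Derive k y * Derive h (k y) = Derive (fun y => h (k y)) y)).
  { generalize (filter_and _ _ k1 hk). apply filter_imp. intros y [[a _] [b _]].
    symmetry. now apply (Derive_comp h k). }
  apply locally_locally in d1.
  assert (d2 : locally x (fun y =>
            Derive (Derive k) y * Derive h (k y)
            + Derive k y * (Derive k y * Derive (Derive h) (k y))
            = Derive (Derive (fun y => h (k y))) y)).
  { generalize (filter_and _ _ d1 (filter_and _ _ k1 hk)). apply filter_imp.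
    intros y [a [[b c] [d f]]]. rewrite <- (Derive_ext_loc _ _ _ a).
    rewrite Derive_mult; [| exact c | now apply (ex_derive_comp (Derive h) k)].
    now rewrite (Derive_comp (Derive h) k) by assumption. }
  split.
  - generalize (filter_and _ _ d1 (filter_and _ _ k1 hk)). apply filter_imp.
    intros y [a [[b c] [d f]]]. split; [now apply (ex_derive_comp h k) |].
    apply (ex_derive_ext_loc _ _ _ a). apply ex_derive_mult; [exact c |].
    now apply (ex_derive_comp (Derive h) k).
  - apply (continuous_ext_loc _ _ _ d2).
    assert (c1 : continuous (Derive k) x) by now apply (ex_derive_continuous (Derive k)).
    assert (c2 : continuous (fun y => Derive h (k y)) x).
    { apply continuous_comp; [exact kc |]. now apply (ex_derive_continuous (Derive h)). }
    apply (continuous_plus (V := R_NormedModule)).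
    + apply (continuous_mult (K := R_AbsRing)); assumption.
    + apply (continuous_mult (K := R_AbsRing)); [assumption |].
      apply (continuous_mult (K := R_AbsRing)); [assumption |].
      now apply continuous_comp.
Qed.

Lemma C2_at_sqrt_div (kappa z : R) : 0 < kappa -> 0 < z -> C2_at (fun y => sqrt (y / kappa)) z.
Proof.
  intros hk hz.
  assert (pos : forall y, 0 < y -> 0 < y / kappa) by (intros; now apply Rdiv_lt_0_compat).
  assert (d1 : forall y, 0 < y ->
            is_derive (fun y => sqrt (y / kappa)) y (/ (2 * kappa) * / sqrt (y / kappa))).
  { intros y hy. pose proof (pos y hy) as hp. pose proof (sqrt_lt_R0 _ hp).
    auto_derive; [exact hp |].
    change (y * / kappa) with (y / kappa). field. lra. }
  assert (loc : forall y, 0 < y -> locally y (fun x => 0 < x)) by (intros; now apply open_gt).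
  assert (e1 : forall y, 0 < y ->
            / (2 * kappa) * / sqrt (y / kappa) = Derive (fun y => sqrt (y / kappa)) y).
  { intros y hy. symmetry. now apply is_derive_unique, d1. }
  assert (d2 : forall y, 0 < y -> is_derive (Derive (fun y => sqrt (y / kappa))) y
            (- / (4 * kappa ^ 2) * / (sqrt (y / kappa) * (y / kappa)))).
  { intros y hy. apply (is_derive_ext_loc (fun y => / (2 * kappa) * / sqrt (y / kappa))).
    - generalize (loc y hy). apply filter_imp. exact e1.
    - pose proof (pos y hy) as hp. pose proof (sqrt_lt_R0 _ hp).
      auto_derive; [repeat split; [exact hp | lra] |].
      change (y * / kappa) with (y / kappa).
      set (s := sqrt (y / kappa)) in *.
      assert (hs : y / kappa = s * s) by (symmetry; apply sqrt_sqrt; lra).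
      rewrite hs. field. lra. }
  split.
  - generalize (loc z hz). apply filter_imp. intros y hy.
    split; eexists; [apply d1 | apply d2]; exact hy.
  - apply (continuous_ext_loc _
      (fun y => - / (4 * kappa ^ 2) * / (sqrt (y / kappa) * (y / kappa)))).
    + generalize (loc z hz). apply filter_imp. intros y hy. symmetry.
      now apply is_derive_unique, d2.
    + pose proof (pos z hz) as hp. pose proof (sqrt_lt_R0 _ hp).
      apply (ex_derive_continuous (V := R_NormedModule)). auto_derive.
      repeat split; [exact hp |]. nra.
Qed.

Section Profiles.

Context (kappa rho : R) (F : index -> R -> R) (hkappa : 0 < kappa).

Lemma axis_interior (s : R) : 0 < s -> kappa * s ^ 2 < rho ->
  Defs.interior (Dtilde0 kappa rho) (on_axis s).
Proof.
  intros hs hr. apply interior_Dtilde0. rewrite J_on_axis.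
  split; [| exact hr]. apply Rmult_lt_0_compat; [exact hkappa |]. apply pow_lt, hs.
Qed.

Lemma locally_axis (s : R) : 0 < s -> kappa * s ^ 2 < rho ->
  locally s (fun r => 0 < r /\ kappa * r ^ 2 < rho).
Proof.
  intros hs hr. apply filter_and; [now apply open_gt |].
  assert (c : continuous (fun r => kappa * r ^ 2) s)
    by (apply (ex_derive_continuous (V := R_NormedModule)); auto_derive; trivial).
  apply (c (fun z => z < rho)), open_lt, hr.
Qed.

Lemma C2_on_axis (h : plane -> R) (s : R) :
  is_C2 (Dtilde0 kappa rho) h -> 0 < s -> kappa * s ^ 2 < rho ->
  C2_at (fun r => h (on_axis r)) s.
Proof.
  intros [_ [hd hdd]] hs hr.
  destruct (hd Defs.one) as [g [_ hg]]. destruct (hdd Defs.one Defs.one) as [g2 [g2c hg2]].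
  assert (d1 : forall r, 0 < r -> kappa * r ^ 2 < rho ->
            partial Defs.one h (on_axis r) = Derive (fun r => h (on_axis r)) r /\
            ex_derive (fun r => h (on_axis r)) r).
  { intros r h1 h2. pose proof (hg _ (axis_interior r h1 h2)) as hp.
    pose proof (is_derive_on_axis _ _ _ hp) as hp'. split; [| eexists; exact hp'].
    transitivity (g (on_axis r)); [exact (is_derive_unique _ _ _ hp) |].
    symmetry. now apply is_derive_unique. }
  assert (d2 : forall r, 0 < r -> kappa * r ^ 2 < rho ->
            is_derive (Derive (fun r => h (on_axis r))) r (g2 (on_axis r))).
  { intros r h1 h2.
    apply (is_derive_ext_loc (fun r => partial Defs.one h (on_axis r))).
    - generalize (locally_axis r h1 h2). apply filter_imp. intros y [a b]. now apply d1.
    - apply is_derive_on_axis, hg2, axis_interior; assumption. }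
  split.
  - generalize (locally_axis s hs hr). apply filter_imp. intros r [a b]. split.
    + now apply d1.
    + eexists. now apply d2.
  - apply (continuous_ext_loc _ (fun r => g2 (on_axis r))).
    + generalize (locally_axis s hs hr). apply filter_imp. intros r [a b].
      symmetry. now apply is_derive_unique, d2.
    + apply continuous_comp.
      * apply continuous_on_axis.
      * apply (continuous_continuous_on (Dtilde0 kappa rho)); [| exact g2c].
        now apply axis_interior.
Qed.

(** [F i] is the composition of [F i o J] on the axis with [z |-> sqrt (z / kappa)]. *)
Lemma profile_C2 (i : index) (z : R) :
  is_C2 (Dtilde0 kappa rho) (FJ kappa F i) -> 0 < z < rho -> C2_at (F i) z.
Proof.
  intros hC hz.
  assert (hp : 0 < z / kappa) by (apply Rdiv_lt_0_compat; lra).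
  assert (inv : forall y, 0 < y -> kappa * sqrt (y / kappa) ^ 2 = y).
  { intros y hy. rewrite pow2_sqrt; [field; lra |]. apply Rlt_le, Rdiv_lt_0_compat; lra. }
  apply (C2_at_ext (fun y => FJ kappa F i (on_axis (sqrt (y / kappa))))).
  - assert (loc : locally z (fun y => 0 < y)) by (apply open_gt; lra).
    generalize loc. apply filter_imp. intros y hy.
    unfold FJ. now rewrite J_on_axis, inv.
  - apply (C2_at_comp (fun r => FJ kappa F i (on_axis r))).
    + apply C2_on_axis; [exact hC | now apply sqrt_lt_R0 | rewrite inv; lra].
    + now apply C2_at_sqrt_div.
Qed.

(** In terms of the distance [r], not of the energy [kappa r^2]: the gradient of
    [F i o J] stays bounded at the origin while the derivative of [F i] may blow up
    at 0. *)
Lemma profile_lipschitz (i : index) :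
  (forall z, continuous (F i) z) ->
  bounded_partials (Dtilde0 kappa rho) (FJ kappa F i) ->
  exists M, 0 <= M /\ forall r s, 0 <= r -> 0 <= s -> kappa * r ^ 2 < rho -> kappa * s ^ 2 < rho ->
    Rabs (F i (kappa * r ^ 2) - F i (kappa * s ^ 2)) <= M * Rabs (r - s).
Proof.
  intros hF [M hM].
  set (phi := fun r => F i (kappa * r ^ 2)).
  assert (hd : forall r, 0 < r -> kappa * r ^ 2 < rho ->
            exists l, is_derive phi r l /\ Rabs l <= M).
  { intros r h1 h2. destruct (hM Defs.one _ (axis_interior r h1 h2)) as [l [hl hlM]].
    exists l. split; [| exact hlM]. apply is_derive_on_axis in hl.
    apply (is_derive_ext (fun r => FJ kappa F i (on_axis r))); [| exact hl].
    intros y. unfold FJ, phi. now rewrite J_on_axis. }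
  exists (Rmax 0 M). split; [apply Rmax_l |].
  assert (main : forall r s, 0 <= r < s -> kappa * s ^ 2 < rho ->
            Rabs (phi r - phi s) <= Rmax 0 M * Rabs (r - s)).
  { intros r s hrs hs.
    assert (below : forall y, r < y <= s -> 0 < y /\ kappa * y ^ 2 < rho).
    { intros y hy. split; [lra |]. eapply Rle_lt_trans; [| exact hs].
      apply Rmult_le_compat_l; [lra |]. apply pow_incr. lra. }
    destruct (MVT_gen phi r s (fun y => if Rlt_dec r y then Derive phi y else 0))
      as [y [hy heq]].
    - intros y hy. rewrite Rmin_left, Rmax_right in hy by lra.
      destruct (Rlt_dec r y); [| lra].
      destruct (hd y) as [l [hl _]]; try (apply below; lra).
      apply Derive_correct. now exists l.
    - intros y _. apply continuity_pt_filterlim.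
      apply (continuous_comp (fun r => kappa * r ^ 2) (F i)); [| apply hF].
      apply (ex_derive_continuous (V := R_NormedModule)); auto_derive; trivial.
    - rewrite Rmin_left, Rmax_right in hy by lra.
      rewrite Rabs_minus_sym, heq, Rabs_mult, (Rabs_minus_sym r s).
      apply Rmult_le_compat_r; [apply Rabs_pos |].
      destruct (Rlt_dec r y).
      + destruct (hd y) as [l [hl hlM]]; try (apply below; lra).
        rewrite (is_derive_unique _ _ _ hl).
        eapply Rle_trans; [exact hlM | apply Rmax_r].
      + rewrite Rabs_R0. apply Rmax_l. }
  intros r s hr hs h1 h2.
  destruct (Rtotal_order r s) as [h | [-> | h]].
  - apply main; lra.
  - rewrite !Rminus_diag, Rabs_R0. lra.
  - rewrite Rabs_minus_sym, (Rabs_minus_sym r s). apply main; lra.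
Qed.

(** Variation of constants: [F2 = - F1 Psi] with [Psi' = 1 / F1^2]. *)
Lemma wronskian (z : R) :
  integral_relation F ->
  (forall i z, continuous (F i) z) ->
  (forall i, is_C2 (Dtilde0 kappa rho) (FJ kappa F i)) ->
  0 < z < rho ->
  F Defs.two z * Derive (F Defs.one) z - F Defs.one z * Derive (F Defs.two) z = 1.
Proof.
  intros [_ [hiso [Psi [hPsi [hrel _]]]]] hF hC.
  set (w := fun y => F Defs.two y * Derive (F Defs.one) y - F Defs.one y * Derive (F Defs.two) y).
  assert (off : forall y, 0 < y < rho -> F Defs.one y <> 0 -> w y = 1).
  { intros y hy hne. unfold w.
    assert (loc : locally y (fun x => F Defs.one x <> 0))
      by (apply (hF Defs.one y (fun v => v <> 0)), open_neq, hne).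
    assert (d1 : ex_derive (F Defs.one) y).
    { destruct (profile_C2 Defs.one y (hC _) hy) as [a _]. now apply locally_singleton in a. }
    assert (d2 : is_derive (F Defs.two) y
              (- (Derive (F Defs.one) y * Psi y + F Defs.one y * (1 / F Defs.one y ^ 2)))).
    { apply (is_derive_ext_loc (fun x => - (F Defs.one x * Psi x))).
      - generalize loc. apply filter_imp. intros x hx. symmetry. now apply hrel.
      - apply (is_derive_opp (V := R_NormedModule)).
        evar_last; [apply (is_derive_mult (K := R_AbsRing))|].
        + apply Derive_correct, d1.
        + now apply hPsi.
        + intros; apply Rmult_comm.
        + reflexivity. }
    rewrite (is_derive_unique _ _ _ d2), hrel by exact hne. field. exact hne. }
  intros hz.
  destruct (Req_dec (F Defs.one z) 0) as [h0 | hne]; [| exact (off z hz hne)].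
  (* At a zero of the first generator the identity holds on a punctured
     neighbourhood, and both sides are continuous. *)
  assert (wc : continuous w z).
  { assert (c1 : forall i, continuous (Derive (F i)) z).
    { intros i. destruct (profile_C2 i z (hC _) hz) as [a _].
      apply locally_singleton in a. now apply (ex_derive_continuous (Derive (F i))). }
    apply (continuous_minus (V := R_NormedModule));
      apply (continuous_mult (K := R_AbsRing)); auto. }
  assert (l1 : filterlim w (locally' z) (locally (w z))).
  { intros Q hQ. apply (filter_le_within (F := locally z)). now apply wc. }
  assert (l2 : filterlim w (locally' z) (locally 1)).
  { apply (filterlim_ext_loc (fun _ => 1)); [| apply filterlim_const].
    assert (loc : locally' z (fun y => 0 < y < rho)).
    { apply (filter_le_within (F := locally z)).
      apply filter_and; [apply open_gt | apply open_lt]; apply hz. }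
    generalize (filter_and _ _ loc (hiso z h0)). apply filter_imp.
    intros y [a b]. symmetry. now apply off. }
  exact (filterlim_locally_unique (F := Rbar_locally' z) w _ _ l1 l2).
Qed.

End Profiles.

(** * The tracking error in the rotating frame *)

(** Coordinatewise, so that the calculus of real functions applies. *)
Definition is_derive2 (x : R -> plane) (t : R) (v : plane) : Prop :=
  is_derive (fun s => fst (x s)) t (fst v) /\ is_derive (fun s => snd (x s)) t (snd v).

(** Only the components of the error along and across the heading enter, which
    turns the two controlled equations into one. *)
Definition frame_env (kappa q : R) (F : index -> R -> R) (omega : R) (xi v : R -> plane)
    (t : R) (a : atom) : R :=
  let c := cos (q * omega * t) in
  let s := sin (q * omega * t) in
  match a with
  | Forward => fst (xi t) * c + snd (xi t) * s
  | Lateral => snd (xi t) * c - fst (xi t) * s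
  | Cosine => cos (omega * t)
  | Sine => sin (omega * t)
  | Gen i n => Derive_n (F i) n (J kappa (xi t))
  | ForwardDrift => - (fst (v t) * c + snd (v t) * s)
  | LateralDrift => fst (v t) * s - snd (v t) * c
  end.

Definition oscillation (F : index -> R -> R) (omega t z : R) : R :=
  F Defs.one z * cos (omega * t) + F Defs.two z * sin (omega * t).

Definition unicycle_error_velocity (kappa q g : R) (F : index -> R -> R) (omega t : R)
    (xi v : plane) : plane :=
  let u := g * sqrt omega * oscillation F omega t (J kappa xi) in
  (u * cos (q * omega * t) - fst v, u * sin (q * omega * t) - snd v).

Lemma cos_sin_sqr (a : R) : cos a * cos a + sin a * sin a = 1.
Proof. rewrite Rplus_comm. exact (sin2_cos2 a). Qed.

Lemma is_derive_sum_squares (x y : R -> R) (k t dx dy : R) :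
  is_derive x t dx -> is_derive y t dy ->
  is_derive (fun s => k * (x s ^ 2 + y s ^ 2)) t (2 * k * (x t * dx + y t * dy)).
Proof.
  intros hx hy. auto_derive; [repeat split; eexists; eassumption |].
    replace (Derive (fun s : R => x s) t) with dx by (symmetry; now apply is_derive_unique).
  replace (Derive (fun s : R => y s) t) with dy by (symmetry; now apply is_derive_unique).
  ring.
Qed.

Lemma is_derive_rotate (x y : R -> R) (k t dx dy : R) :
  is_derive x t dx -> is_derive y t dy ->
  is_derive (fun s => x s * cos (k * s) + y s * sin (k * s)) t
    ((dx + k * y t) * cos (k * t) + (dy - k * x t) * sin (k * t)).
Proof.
  intros hx hy. auto_derive; [repeat split; eexists; eassumption |].
  replace (Derive (fun s : R => x s) t) with dx by (symmetry; now apply is_derive_unique).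
  replace (Derive (fun s : R => y s) t) with dy by (symmetry; now apply is_derive_unique).
  ring.
Qed.

Lemma is_derive_J (kappa t : R) (xi : R -> plane) (w : plane) :
  is_derive2 xi t w ->
  is_derive (fun s => J kappa (xi s)) t
    (2 * kappa * (fst (xi t) * fst w + snd (xi t) * snd w)).
Proof.
  intros [h1 h2].
  apply (is_derive_ext (fun s => kappa * (fst (xi s) ^ 2 + snd (xi s) ^ 2))).
  - intros s. now rewrite J_expand.
  - exact (is_derive_sum_squares _ _ kappa t _ _ h1 h2).
Qed.

Lemma frame_env_cost (kappa q : R) F omega xi v t :
  eval (frame_env kappa q F omega xi v t) (cost kappa) = J kappa (xi t).
Proof.
  rewrite J_expand. simpl. pose proof (cos_sin_sqr (q * omega * t)) as h.
  destruct (xi t) as [x y]. simpl.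
  set (c := cos (q * omega * t)) in *. set (s := sin (q * omega * t)) in *.
  transitivity (kappa * (x ^ 2 + y ^ 2) * (c * c + s * s)); [ring |].
  rewrite h. ring.
Qed.

Lemma frame_env_derive (kappa q g : R) F omega xi v t :
  is_derive2 xi t (unicycle_error_velocity kappa q g F omega t (xi t) (v t)) ->
  (forall i, C2_at (F i) (J kappa (xi t))) ->
  forall a, (atom_order a <= 1)%nat ->
    is_derive (fun s => frame_env kappa q F omega xi v s a) t
      (let env := frame_env kappa q F omega xi v t in
       omega * eval env (d_phase q a) + sqrt omega * eval env (d_input kappa g a)
       + eval env (d_drift kappa a)).
Proof.
  intros hxi hC a ha.
  assert (hz := is_derive_J kappa t xi _ hxi).
  destruct hxi as [h1 h2].
  pose proof (cos_sin_sqr (q * omega * t)) as hcs.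
  cbv zeta. destruct a as [ | | | | i n | | ]; simpl in ha; try lia.
  - evar_last; [exact (is_derive_rotate _ _ (q * omega) t _ _ h1 h2) |].
    simpl. unfold oscillation.
    set (c := cos (q * omega * t)) in *. set (s := sin (q * omega * t)) in *.
    assert (hs : s * s = 1 - c * c) by lra.
    ring [hs].
  - assert (h1' : is_derive (fun s => - fst (xi s)) t
        (- fst (unicycle_error_velocity kappa q g F omega t (xi t) (v t))))
      by exact (is_derive_opp (V := R_NormedModule) _ _ _ h1).
    evar_last.
    + apply (is_derive_ext (fun s => snd (xi s) * cos (q * omega * s)
                                     + - fst (xi s) * sin (q * omega * s))).
      * intros s. simpl. ring.
      * exact (is_derive_rotate _ _ (q * omega) t _ _ h2 h1').
    + simpl. unfold oscillation. ring.
  - simpl. auto_derive; [trivial | ring].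
  - simpl. auto_derive; [trivial | ring].
  - assert (hd : is_derive (Derive_n (F i) n) (J kappa (xi t))
                   (Derive_n (F i) (n + 1) (J kappa (xi t)))).
    { destruct (hC i) as [hl _]. apply locally_singleton in hl.
      destruct n as [| [| n]]; [| | lia]; simpl; apply Derive_correct, hl. }
    simpl in *. unfold oscillation in *.
    evar_last.
    + apply (is_derive_comp (Derive_n (F i) n) (fun s => J kappa (xi s))); [exact hd | exact hz].
    + unfold scal; simpl; unfold mult; simpl.
      set (c := cos (q * omega * t)) in *. set (s := sin (q * omega * t)) in *.
      set (G := Derive_n (F i) (n + 1) (J kappa (xi t))).
      set (x1 := fst (xi t)). set (x2 := snd (xi t)). set (v1 := fst (v t)). set (v2 := snd (v t)).
      assert (hs : s * s = 1 - c * c) by lra.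
      ring [hs].
Qed.

Lemma bounded_on_segment (h : R -> R) (a b : R) :
  (forall x, a <= x <= b -> continuous h x) ->
  exists B, 0 <= B /\ forall x, a <= x <= b -> Rabs (h x) <= B.
Proof.
  intros hc. destruct (Rle_lt_dec a b) as [hab | hab].
  - destruct (continuity_ab_maj (fun x => Rabs (h x)) a b hab) as [M [hM _]].
    + intros x hx. apply continuity_pt_filterlim.
      exact (continuous_comp h Rabs x (hc x hx) (continuous_Rabs (h x))).
    + exists (Rabs (h M)). split; [apply Rabs_pos | exact hM].
  - exists 0. split; [lra |]. intros x hx. lra.
Qed.

Lemma generators_bounded (F : index -> R -> R) (a b : R) :
  (forall i z, a <= z <= b -> C2_at (F i) z) ->
  exists B, forall i n z, (n <= 2)%nat -> a <= z <= b -> Rabs (Derive_n (F i) n z) <= B.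
Proof.
  intros hC.
  assert (hc : forall i n z, (n <= 2)%nat -> a <= z <= b -> continuous (Derive_n (F i) n) z).
  { intros i n z hn hz. destruct (hC i z hz) as [hl h2]. apply locally_singleton in hl.
    destruct n as [| [| [| n]]]; [| | exact h2 | lia].
    - apply (ex_derive_continuous (F i)), hl.
    - apply (ex_derive_continuous (Derive (F i))), hl. }
  assert (hi : forall i, exists B, forall n z, (n <= 2)%nat -> a <= z <= b ->
                Rabs (Derive_n (F i) n z) <= B).
  { intros i.
    destruct (bounded_on_segment (Derive_n (F i) 0) a b) as [B0 [h0 b0]];
      [intros; apply hc; auto with arith |].
    destruct (bounded_on_segment (Derive_n (F i) 1) a b) as [B1 [h1 b1]];
      [intros; apply hc; auto with arith |].
    destruct (bounded_on_segment (Derive_n (F i) 2) a b) as [B2 [h2 b2]];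
      [intros; apply hc; auto with arith |].
    exists (B0 + B1 + B2). intros n z hn hz.
    specialize (b0 z hz). specialize (b1 z hz). specialize (b2 z hz).
    destruct n as [| [| [| n]]]; [lra | lra | lra | lia]. }
  destruct (hi Defs.one) as [B1 h1]. destruct (hi Defs.two) as [B2 h2].
  exists (Rmax B1 B2). intros [|] n z hn hz.
  - eapply Rle_trans; [now apply h1 | apply Rmax_l].
  - eapply Rle_trans; [now apply h2 | apply Rmax_r].
Qed.

Lemma Rabs_combination (x y a b M : R) :
  Rabs a <= 1 -> Rabs b <= 1 -> x ^ 2 + y ^ 2 <= M ^ 2 -> 0 <= M ->
  Rabs (x * a + y * b) <= 2 * M.
Proof.
  intros ha hb h hM.
  assert (hx : Rabs x <= M) by (apply Rabs_le; split; nra).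
  assert (hy : Rabs y <= M) by (apply Rabs_le; split; nra).
  eapply Rle_trans; [apply Rabs_triang |]. rewrite !Rabs_mult.
  pose proof (Rabs_pos x). pose proof (Rabs_pos y).
  pose proof (Rabs_pos a). pose proof (Rabs_pos b). nra.
Qed.

Definition annular_lyapunov (kappa q g : R) (F : index -> R -> R) (omega : R)
    (xi v : R -> plane) (t : R) : R :=
  corrected_cost kappa q g omega (frame_env kappa q F omega xi v t).

Lemma Rabs_cos_le (a : R) : Rabs (cos a) <= 1.
Proof. apply Rabs_le. pose proof (COS_bound a). lra. Qed.

Lemma Rabs_sin_le (a : R) : Rabs (sin a) <= 1.
Proof. apply Rabs_le. pose proof (SIN_bound a). lra. Qed.

(** The radial part of the drift is at most [nu] in size, against a mean descent
    that grows with the distance and exceeds it from the level [lambda] on. *)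
Lemma annular_decrease (kappa q g theta nu lambda rho' : R) (F : index -> R -> R) :
  0 < kappa -> 0 < q < 1 -> g ^ 2 = 4 * theta * (1 - q ^ 2) -> 0 < theta -> 0 <= nu ->
  0 < lambda -> lambda <= rho' ->
  nu <= 2 * theta * sqrt (kappa * lambda) ->
  (forall i z, lambda <= z <= rho' -> C2_at (F i) z) ->
  (forall z, lambda <= z <= rho' ->
     F Defs.two z * Derive (F Defs.one) z - F Defs.one z * Derive (F Defs.two) z = 1) ->
  exists K, 0 < K /\ forall omega xi v t,
    1 <= omega ->
    is_derive2 xi t (unicycle_error_velocity kappa q g F omega t (xi t) (v t)) ->
    norm (v t) <= nu ->
    lambda <= J kappa (xi t) <= rho' ->
    approx_lyapunov (fun s => J kappa (xi s)) (annular_lyapunov kappa q g F omega xi v)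
      (2 * sqrt (kappa * lambda) * (2 * theta * sqrt (kappa * lambda) - nu) - K / sqrt omega)
      (K / sqrt omega) t.
Proof.
  intros hk hq hg hth hnu hl hlr hgap hC hW.
  destruct (generators_bounded F lambda rho' hC) as [BF hBF].
  set (M := sqrt (rho' / kappa)).
  assert (hrk : 0 < rho' / kappa) by (apply Rdiv_lt_0_compat; lra).
  assert (hM : 0 <= M) by apply sqrt_pos.
  assert (hMM : M ^ 2 = rho' / kappa) by (unfold M; rewrite pow2_sqrt; lra).
  assert (hm : detuning q <> 0) by (unfold detuning; nra).
  destruct (averaged_decrease kappa q g (2 * M + 1 + Rmax 0 BF + 2 * nu) hm ltac:(lra))
    as [K [hK hav]].
  exists K. split; [exact hK |].
  intros omega xi v t ho hxi hv hz.
  assert (hv2 : fst (v t) ^ 2 + snd (v t) ^ 2 <= nu ^ 2).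
  { rewrite <- norm_sqr. apply pow_incr. split; [apply norm_ge_0 | exact hv]. }
  assert (hx2 : fst (xi t) ^ 2 + snd (xi t) ^ 2 <= M ^ 2).
  { rewrite hMM. apply Rle_div_r; [exact hk |]. rewrite Rmult_comm, <- J_expand. apply hz. }
  destruct (hav omega (frame_env kappa q F omega xi v) t ho) as [h1 [l [h2 h3]]].
  - pose proof (Rmax_l 0 BF). pose proof (Rmax_r 0 BF).
    pose proof (Rabs_cos_le (q * omega * t)) as hc. pose proof (Rabs_sin_le (q * omega * t)) as hs.
    assert (hs' : Rabs (- sin (q * omega * t)) <= 1) by now rewrite Rabs_Ropp.
    assert (hc' : Rabs (- cos (q * omega * t)) <= 1) by now rewrite Rabs_Ropp.
    intros a ha. destruct a as [ | | | | i n | | ]; simpl in *.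
    + pose proof (Rabs_combination _ _ _ _ M hc hs hx2 hM). lra.
    + pose proof (Rabs_combination _ _ _ _ M hs' hc hx2 hM) as h.
      replace (snd (xi t) * _ - _) with (fst (xi t) * - sin (q * omega * t)
        + snd (xi t) * cos (q * omega * t)) by ring. lra.
    + pose proof (Rabs_cos_le (omega * t)). lra.
    + pose proof (Rabs_sin_le (omega * t)). lra.
    + pose proof (hBF i n _ ha hz). lra.
    + pose proof (Rabs_combination _ _ _ _ nu hc hs hv2 hnu). rewrite Rabs_Ropp. lra.
    + pose proof (Rabs_combination _ _ _ _ nu hs hc' hv2 hnu) as h.
      replace (fst (v t) * _ - _) with (fst (v t) * sin (q * omega * t)
        + snd (v t) * - cos (q * omega * t)) by ring. lra.
  - apply frame_env_derive; [exact hxi |]. intros i. now apply hC.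
  - apply cos_sin_sqr.
  - exact (hW _ hz).
  - unfold approx_lyapunov, annular_lyapunov. rewrite frame_env_cost in h1, h3.
    split; [exact h1 |]. exists l. split; [exact h2 |].
    eapply Rle_trans; [exact h3 |].
    assert (hdrift : eval (frame_env kappa q F omega xi v t) (deriv (d_drift kappa) (cost kappa))
              = - (2 * kappa) * (fst (xi t) * fst (v t) + snd (xi t) * snd (v t))).
    { simpl. pose proof (cos_sin_sqr (q * omega * t)) as h.
      destruct (xi t) as [x1 x2], (v t) as [v1 v2]; simpl.
      set (c := cos (q * omega * t)) in *. set (s := sin (q * omega * t)) in *.
      assert (hs : s * s = 1 - c * c) by lra. ring [hs]. }
    rewrite hdrift.
    (* [sqrt (kappa z) = kappa r], and the mean descent minus the drift,
       [2 (kappa r) (2 theta (kappa r) - nu)], increases with [r] from [w0] on. *)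
    set (r := norm (xi t)).
    assert (hr : 0 <= r) by apply norm_ge_0.
    assert (hJr : J kappa (xi t) = kappa * r ^ 2) by reflexivity.
    assert (hcs : - (fst (xi t) * fst (v t) + snd (xi t) * snd (v t)) <= r * nu).
    { pose proof (inner_le_norms (xi t) (opp (v t))) as h.
      rewrite (norm_opp (V := plane)) in h. fold r in h.
      change (fst (xi t) * - fst (v t) + snd (xi t) * - snd (v t) <= r * norm (v t)) in h.
      assert (r * norm (v t) <= r * nu) by (apply Rmult_le_compat_l; assumption).
      lra. }
    set (w0 := sqrt (kappa * lambda)) in *.
    assert (hw0 : 0 <= w0) by apply sqrt_pos.
    assert (hw : w0 <= kappa * r).
    { unfold w0. rewrite <- (sqrt_pow2 (kappa * r)) by nra. apply sqrt_le_1; nra. }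
    rewrite hJr, hg. unfold detuning in *.
    replace (kappa * (4 * theta * (1 - q ^ 2)) / (1 - q ^ 2)) with (4 * kappa * theta)
      by (field; exact hm).
    assert (hmain : 2 * w0 * (2 * theta * w0 - nu)
              <= 2 * (kappa * r) * (2 * theta * (kappa * r) - nu)).
    { apply Rmult_le_compat; nra. }
    nra.
Qed.

(** * One-sided derivatives, extension and uniqueness *)

Definition has_slope (I : R -> Prop) (h : R -> R) (t l : R) : Prop :=
  forall eps : posreal, exists d : posreal, forall s, I s -> s <> t -> Rabs (s - t) < d ->
    Rabs ((h s - h t) / (s - t) - l) < eps.

Lemma is_derive_within_slopes (I : R -> Prop) (x : R -> plane) (t : R) (v : plane) :
  is_derive_within I x t v <->
  has_slope I (fun s => fst (x s)) t (fst v) /\ has_slope I (fun s => snd (x s)) t (snd v).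
Proof.
  unfold is_derive_within.
  transitivity (forall eps : posreal, within I (locally' t)
    (fun s => ball v eps (scal (/ (s - t)) (minus (x s) (x t))))).
  { apply (filterlim_locally (U := plane) (F := within I (locally' t))). }
  split.
  - intros h. split; intros eps; destruct (h eps) as [d hd]; exists d; intros s hI hne hs;
      destruct (hd s hs hne hI) as [h1 h2].
    + unfold Rdiv. rewrite Rmult_comm. exact h1.
    + unfold Rdiv. rewrite Rmult_comm. exact h2.
  - intros [h1 h2] eps. destruct (h1 eps) as [d1 hd1]. destruct (h2 eps) as [d2 hd2].
    assert (hd : 0 < Rmin d1 d2) by (apply Rmin_pos; apply cond_pos).
    exists (mkposreal _ hd). intros s hs hne hI. simpl in hs.
    assert (hs' : Rabs (s - t) < Rmin d1 d2) by exact hs.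
    split.
    + specialize (hd1 s hI hne (Rlt_le_trans _ _ _ hs' (Rmin_l _ _))).
      unfold Rdiv in hd1. rewrite Rmult_comm in hd1. exact hd1.
    + specialize (hd2 s hI hne (Rlt_le_trans _ _ _ hs' (Rmin_r _ _))).
      unfold Rdiv in hd2. rewrite Rmult_comm in hd2. exact hd2.
Qed.

Lemma is_derive_slope (I : R -> Prop) (h : R -> R) (t l : R) :
  is_derive h t l -> has_slope I h t l.
Proof.
  intros hd eps. apply is_derive_Reals in hd.
  destruct (hd eps (cond_pos eps)) as [d hd']. exists d. intros s _ hne hs.
  specialize (hd' (s - t) ltac:(lra) hs).
  now replace (t + (s - t)) with s in hd' by ring.
Qed.

Lemma slope_is_derive (h : R -> R) (t l : R) :
  has_slope (fun _ => True) h t l -> is_derive h t l.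
Proof.
  intros hs. apply is_derive_Reals. intros eps heps.
  destruct (hs (mkposreal eps heps)) as [d hd]. exists d. intros k hk0 hk.
  specialize (hd (t + k) I). replace (t + k - t) with k in hd by ring.
  apply hd; [lra | exact hk].
Qed.

Lemma is_derive2_within (I : R -> Prop) (x : R -> plane) (t : R) (v : plane) :
  is_derive2 x t v -> is_derive_within I x t v.
Proof. intros [h1 h2]. apply is_derive_within_slopes. split; now apply is_derive_slope. Qed.

Lemma Rbar_lt_locally (t : R) (T : Rbar) : Rbar_lt t T ->
  exists d : posreal, forall s, Rabs (s - t) < d -> Rbar_lt s T.
Proof. intros h. destruct (open_Rbar_lt' t T h) as [d hd]. exists d. exact hd. Qed.

(** Continuing by the tangent line to the left of [t0] turns the one-sided
    derivative at the initial time into an ordinary one. *)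
Lemma extend_slopes (h d : R -> R) (t0 : R) (T : Rbar) :
  (forall t, t0 <= t -> Rbar_lt t T ->
     has_slope (fun s => t0 <= s /\ Rbar_lt s T) h t (d t)) ->
  exists k, (forall t, t0 <= t -> k t = h t) /\
    forall t, t0 <= t -> Rbar_lt t T -> is_derive k t (d t).
Proof.
  intros hs.
  exists (fun t => if Rle_dec t0 t then h t else h t0 + (t - t0) * d t0). split.
  { intros t ht. destruct (Rle_dec t0 t); [reflexivity | lra]. }
  intros t ht hT. apply slope_is_derive. intros eps.
  destruct (hs t ht hT eps) as [e1 he1].
  destruct (Rbar_lt_locally t T hT) as [e2 he2].
  assert (he3 : 0 < if Rlt_dec t0 t then t - t0 else 1) by (destruct (Rlt_dec t0 t); lra).
  assert (he : 0 < Rmin (Rmin e1 e2) (if Rlt_dec t0 t then t - t0 else 1)).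
  { apply Rmin_pos; [apply Rmin_pos; apply cond_pos | exact he3]. }
  exists (mkposreal _ he). intros s _ hne hst. simpl in hst.
  apply Rmin_Rgt_l in hst. destruct hst as [hst h3]. apply Rmin_Rgt_l in hst.
  destruct hst as [h1 h2].
  destruct (Rle_dec t0 t) as [_ |]; [| lra].
  destruct (Rle_dec t0 s) as [hs0 | hs0].
  - apply he1; [| exact hne | exact h1]. split; [exact hs0 | now apply he2].
  - destruct (Rlt_dec t0 t) as [hlt | hge].
    + apply Rabs_def2 in h3. lra.
    + assert (t = t0) as -> by lra.
      replace ((h t0 + (s - t0) * d t0 - h t0) / (s - t0) - d t0) with 0
        by (field; lra).
      rewrite Rabs_R0. apply cond_pos.
Qed.

Lemma extend_path (x d : R -> plane) (t0 : R) (T : Rbar) :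
  (forall t, t0 <= t -> Rbar_lt t T ->
     is_derive_within (fun s => t0 <= s /\ Rbar_lt s T) x t (d t)) ->
  exists y, (forall t, t0 <= t -> y t = x t) /\
    forall t, t0 <= t -> Rbar_lt t T -> is_derive2 y t (d t).
Proof.
  intros h.
  destruct (extend_slopes (fun t => fst (x t)) (fun t => fst (d t)) t0 T) as [k1 [e1 d1]].
  { intros t ht hT. apply (is_derive_within_slopes _ x t (d t)). now apply h. }
  destruct (extend_slopes (fun t => snd (x t)) (fun t => snd (d t)) t0 T) as [k2 [e2 d2]].
  { intros t ht hT. apply (is_derive_within_slopes _ x t (d t)). now apply h. }
  exists (fun t => (k1 t, k2 t)). split.
  - intros t ht. rewrite e1, e2 by exact ht. now destruct (x t).
  - intros t ht hT. split; [now apply d1 | now apply d2].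
Qed.

Lemma continuous_pair (x y : R -> R) (t : R) :
  continuous x t -> continuous y t -> continuous (fun s => (x s, y s) : plane) t.
Proof.
  intros hx hy Q [d hd].
  assert (h1 : locally t (fun s => ball (x t) d (x s))) by exact (hx _ (locally_ball (x t) d)).
  assert (h2 : locally t (fun s => ball (y t) d (y s))) by exact (hy _ (locally_ball (y t) d)).
  apply (filter_imp (F := locally t) _ _) with (2 := filter_and _ _ h1 h2). intros s [a b].
  apply hd. split; [exact a | exact b].
Qed.

Lemma is_derive2_continuous (x : R -> plane) (t : R) (v : plane) :
  is_derive2 x t v -> continuous x t.
Proof.
  intros [h1 h2].
  apply (continuous_ext (fun s => (fst (x s), snd (x s)) : plane)).
  - intros s. now destruct (x s).
  - apply continuous_pair.
    + apply (ex_derive_continuous (V := R_NormedModule) (fun s => fst (x s))). eexists; exact h1.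
    + apply (ex_derive_continuous (V := R_NormedModule) (fun s => snd (x s))). eexists; exact h2.
Qed.

Lemma is_derive_is_derive2 (x : R -> plane) (t : R) (v : plane) :
  is_derive x t v -> is_derive2 x t v.
Proof.
  intros h. split.
  - exact (filterdiff_comp x (fst : plane -> R) _ _ h
      (filterdiff_linear _ (is_linear_fst (U := R_NormedModule) (V := R_NormedModule)))).
  - exact (filterdiff_comp x (snd : plane -> R) _ _ h
      (filterdiff_linear _ (is_linear_snd (U := R_NormedModule) (V := R_NormedModule)))).
Qed.

Lemma is_derive2_minus (x y : R -> plane) (t : R) (v w : plane) :
  is_derive2 x t v -> is_derive2 y t w ->
  is_derive2 (fun s => minus (x s) (y s)) t (minus v w).
Proof.
  intros [h1 h2] [h3 h4]. split.
  - exact (is_derive_minus (V := R_NormedModule) _ _ _ _ _ h1 h3).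
  - exact (is_derive_minus (V := R_NormedModule) _ _ _ _ _ h2 h4).
Qed.

(** The squared distance times [exp (- 2 L t)] does not increase. *)
Lemma lipschitz_unique (f : R -> plane -> plane) (L t0 t1 : R) (x y : R -> plane) :
  t0 <= t1 ->
  (forall t a b, norm (minus (f t a) (f t b)) <= L * norm (minus a b)) ->
  (forall t, t0 <= t <= t1 -> is_derive2 x t (f t (x t)) /\ is_derive2 y t (f t (y t))) ->
  x t0 = y t0 -> x t1 = y t1.
Proof.
  intros ht hL hd h0.
  set (V := fun t => J 1 (minus (x t) (y t)) * exp (- (2 * L) * (t - t0))).
  assert (hV : V t1 <= V t0 - 0 * (t1 - t0)).
  { apply decrease_along; [exact ht |]. intros t hin. destruct (hd t hin) as [hx hy].
    pose proof (is_derive_J 1 t _ _ (is_derive2_minus x y t _ _ hx hy)) as hJ.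
    assert (hexp : is_derive (fun t => exp (- (2 * L) * (t - t0))) t
              (- (2 * L) * exp (- (2 * L) * (t - t0)))).
    { auto_derive; [trivial |]. unfold Rminus. ring. }
    eexists. split.
    - exact (is_derive_mult (K := R_AbsRing) _ _ t _ _ hJ hexp Rmult_comm).
    - pose proof (inner_le_norms (minus (x t) (y t)) (minus (f t (x t)) (f t (y t)))) as hin'.
      pose proof (hL t (x t) (y t)) as hl.
      pose proof (exp_pos (- (2 * L) * (t - t0))) as he.
      pose proof (norm_ge_0 (minus (x t) (y t))) as hn.
      set (E := exp (- (2 * L) * (t - t0))) in *.
      set (u := minus (x t) (y t)) in *. set (w := minus (f t (x t)) (f t (y t))) in *.
      change (2 * 1 * (fst u * fst w + snd u * snd w) * E
              + 1 * norm u ^ 2 * (- (2 * L) * E) <= - 0).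
      set (n := norm u) in *. set (i := fst u * fst w + snd u * snd w) in *.
      assert (n * norm w <= n * (L * n)) by (apply Rmult_le_compat_l; assumption).
      assert (hneg : i - L * (n * n) <= 0) by lra.
      pose proof (Rmult_le_compat_l (2 * E) _ _ ltac:(lra) hneg). lra. }
  assert (hV0 : V t0 = 0).
  { unfold V, J. rewrite h0, minus_eq_zero.
    replace (norm _) with 0 by (symmetry; apply (norm_zero (V := plane))). simpl. ring. }
  rewrite hV0 in hV. unfold V, J in hV.
  pose proof (exp_pos (- (2 * L) * (t1 - t0))) as he.
  apply (minus_zero_eq (G := plane)), (norm_eq_zero (V := plane)).
  pose proof (norm_ge_0 (minus (x t1) (y t1))) as hn.
  set (n := norm (minus (x t1) (y t1))) in *.
  assert (1 * n ^ 2 <= 0) by (apply Rnot_lt_le; intros hlt;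
    pose proof (Rmult_lt_0_compat _ _ hlt he); lra). nra.
Qed.

(** * The closed loop *)

Lemma norm_polar (u a : R) : norm ((u * cos a, u * sin a) : plane) = Rabs u.
Proof.
  pose proof (norm_sqr (u * cos a, u * sin a)) as h. simpl fst in h; simpl snd in h.
  rewrite <- (sqrt_pow2 (norm _)) by apply norm_ge_0. rewrite h.
  replace ((u * cos a) ^ 2 + (u * sin a) ^ 2) with (Rsqr u).
  - apply sqrt_Rsqr_abs.
  - pose proof (cos_sin_sqr a) as hc. unfold Rsqr.
    transitivity (u * u * (cos a * cos a + sin a * sin a)); [rewrite hc |]; ring.
Qed.

Lemma norm_minus_polar (u v a : R) :
  norm (minus ((u * cos a, u * sin a) : plane) (v * cos a, v * sin a)) = Rabs (u - v).
Proof.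
  rewrite <- (norm_polar (u - v) a). f_equal.
  unfold minus, plus, opp; simpl. unfold prod_plus, prod_opp, plus, opp; simpl.
  f_equal; ring.
Qed.

Lemma Rmin_1_lipschitz (a r s : R) : Rabs (Rmin r a - Rmin s a) <= Rabs (r - s).
Proof.
  unfold Rmin, Rabs.
  destruct (Rle_dec r a), (Rle_dec s a); repeat destruct Rcase_abs; lra.
Qed.

Lemma continuous_Rmin (a x : R) : continuous (fun z => Rmin z a) x.
Proof.
  apply (continuous_ext (fun z => (z + a - Rabs (z - a)) / 2)).
  - intros z. unfold Rmin, Rabs. destruct (Rle_dec z a), (Rcase_abs (z - a)); lra.
  - apply continuity_pt_filterlim. unfold Rdiv. reg.
Qed.

Lemma Rmin_mult_sqr (kappa R' r : R) : 0 <= kappa -> 0 <= r -> 0 <= R' ->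
  Rmin (kappa * r ^ 2) (kappa * R' ^ 2) = kappa * Rmin r R' ^ 2.
Proof.
  intros hk hr hR. unfold Rmin at 2. destruct (Rle_dec r R').
  - apply Rmin_left, Rmult_le_compat_l, pow_incr; lra.
  - apply Rmin_right, Rmult_le_compat_l, pow_incr; lra.
Qed.

Lemma level_set_nbhd (kappa lambda eps : R) (gamma : R -> plane) (t : R) (x : plane) :
  0 < kappa -> 0 <= lambda -> 0 < eps ->
  J kappa (minus x (gamma t)) < kappa * (sqrt (lambda / kappa) + eps) ^ 2 ->
  nbhd eps (level_sets kappa lambda gamma t) x.
Proof.
  intros hk hl he h.
  set (r0 := sqrt (lambda / kappa)) in *.
  assert (hr0 : 0 <= r0) by apply sqrt_pos.
  assert (hr2 : kappa * r0 ^ 2 = lambda).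
  { unfold r0. rewrite pow2_sqrt; [field; lra |]. now apply Rle_mult_inv_pos. }
  unfold level_sets.
  set (xi := minus x (gamma t)) in *.
  set (r := norm xi).
  assert (hr : 0 <= r) by apply norm_ge_0.
  assert (hJ : kappa * r ^ 2 < kappa * (r0 + eps) ^ 2) by exact h.
  assert (hlt : r < r0 + eps).
  { apply Rmult_lt_reg_l in hJ; [| exact hk]. apply Rnot_le_lt. intros hle.
    assert ((r0 + eps) ^ 2 <= r ^ 2) by (apply pow_incr; lra). lra. }
  destruct (Rle_lt_dec r r0) as [hin | hout].
  - exists x. split.
    + change (kappa * r ^ 2 <= lambda). rewrite <- hr2.
      apply Rmult_le_compat_l; [lra |]. apply pow_incr. lra.
    + rewrite minus_eq_zero. replace (norm _) with 0; [exact he |].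
      symmetry. apply (norm_zero (V := plane)).
  - exists (plus (gamma t) (scal (r0 / r) xi)). split.
    + rewrite (plus_minus_cancel (G := plane)). unfold J.
      rewrite <- hr2. apply Rmult_le_compat_l; [lra |]. apply pow_incr.
      split; [apply norm_ge_0 |].
      eapply Rle_trans; [exact (norm_scal (V := plane) (r0 / r) xi) |]. fold r. unfold abs; simpl.
      rewrite Rabs_pos_eq by (apply Rle_mult_inv_pos; lra). right. field. lra.
    + assert (e1 : minus x (plus (gamma t) (scal (r0 / r) xi)) = scal (1 - r0 / r) xi).
      { unfold xi. destruct x as [x1 x2]. destruct (gamma t) as [g1 g2].
        unfold minus, plus, opp, scal; simpl.
        unfold prod_plus, prod_opp, prod_scal, plus, opp, scal; simpl.
        unfold mult; simpl. f_equal; ring. }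
      rewrite e1.
      eapply Rle_lt_trans; [exact (norm_scal (V := plane) (1 - r0 / r) xi) |].
      fold r. unfold abs; simpl.
      assert (r0 / r <= 1) by (apply Rle_div_l; lra).
      rewrite Rabs_pos_eq by lra.
      replace ((1 - r0 / r) * r) with (r - r0) by (field; lra). lra.
Qed.

Lemma nbhd_level_set (kappa lambda delta : R) (gamma : R -> plane) (t : R) (x : plane) :
  0 < kappa -> 0 <= lambda ->
  nbhd delta (level_sets kappa lambda gamma t) x ->
  J kappa (minus x (gamma t)) <= kappa * (sqrt (lambda / kappa) + delta) ^ 2.
Proof.
  intros hk hl [y [hy hxy]]. unfold level_sets, J in *.
  set (r0 := sqrt (lambda / kappa)) in *.
  assert (hr2 : r0 ^ 2 = lambda / kappa).
  { unfold r0. rewrite pow2_sqrt; [reflexivity |]. now apply Rle_mult_inv_pos. }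
  assert (hr0 : 0 <= r0) by apply sqrt_pos.
  assert (hn : norm (minus y (gamma t)) <= r0).
  { unfold r0. rewrite <- (sqrt_pow2 (norm _)) by apply norm_ge_0. apply sqrt_le_1_alt.
    apply (proj1 (Rle_div_r _ _ _ hk)). rewrite Rmult_comm. exact hy. }
  apply Rmult_le_compat_l; [lra |]. apply pow_incr. split; [apply norm_ge_0 |].
  pose proof (norm_minus_triangle x y (gamma t)) as ht.
  eapply Rle_trans; [exact ht |]. lra.
Qed.

Section Unicycle.

Context (kappa rho rho' nu lambda theta : R) (F : index -> R -> R).
Context (gamma dgamma : R -> plane) (k : nat).
Hypothesis hkappa : 0 < kappa.
Hypothesis hF : forall i z, continuous (F i) z.
Hypothesis hC2 : forall i, is_C2 (Dtilde0 kappa rho) (FJ kappa F i).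
Hypothesis hbp : forall i, bounded_partials (Dtilde0 kappa rho) (FJ kappa F i).
Hypothesis hrel : integral_relation F.
Hypothesis hk : (1 < k)%nat.
Hypothesis hlambda : 0 < lambda < rho'.
Hypothesis hrho' : rho' < rho.
Hypothesis hnu : 0 <= nu.
Hypothesis htheta0 : 0 < theta.
Hypothesis hgap : nu < 2 * theta * sqrt (kappa * lambda).
Hypothesis hgamma : forall t, 0 <= t -> is_derive2 gamma t (dgamma t).
Hypothesis hdgamma : forall t, 0 <= t -> norm (dgamma t) <= nu.

Definition system : R -> R -> plane -> plane := unicycle k (control kappa theta k F gamma).

(** Held constant beyond the level [rho'], so that the bounds valid in the disc become
    global. *)
Definition clipped_gen (i : index) (z : R) : R := F i (Rmin z rho').

Definition clipped_system : R -> R -> plane -> plane :=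
  unicycle k (control kappa theta k clipped_gen (fun t => gamma (Rmax 0 t))).

(** Clipping the energy amounts to clipping the radius, a Lipschitz operation. *)
Lemma clipped_gen_lipschitz (i : index) :
  exists M, 0 <= M /\ forall xi eta : plane,
    Rabs (clipped_gen i (J kappa xi) - clipped_gen i (J kappa eta)) <= M * norm (minus xi eta).
Proof.
  destruct (profile_lipschitz kappa rho F hkappa i (hF i) (hbp i)) as [M [hM hlip]].
  exists M. split; [exact hM |]. intros xi eta. unfold clipped_gen, J.
  set (R' := sqrt (rho' / kappa)).
  assert (hR' : 0 <= R') by apply sqrt_pos.
  assert (hR2 : kappa * R' ^ 2 = rho').
  { unfold R'. rewrite pow2_sqrt; [field; lra |]. apply Rle_mult_inv_pos; lra. }
  pose proof (norm_ge_0 xi) as h1. pose proof (norm_ge_0 eta) as h2.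
  rewrite <- hR2, !Rmin_mult_sqr by lra.
  assert (hclip : forall r, 0 <= r -> 0 <= Rmin r R' /\ kappa * Rmin r R' ^ 2 < rho).
  { intros r hr. assert (hm : 0 <= Rmin r R') by (apply Rmin_glb; lra). split; [exact hm |].
    apply Rle_lt_trans with rho'; [| exact hrho']. rewrite <- hR2.
    apply Rmult_le_compat_l; [lra |]. apply pow_incr. split; [exact hm | apply Rmin_r]. }
  eapply Rle_trans; [apply hlip; apply hclip; assumption |].
  apply Rmult_le_compat_l; [exact hM |].
  eapply Rle_trans; [apply Rmin_1_lipschitz |].
  exact (norm_triangle_inv xi eta).
Qed.

Lemma clipped_gen_bounded (i : index) :
  exists B, 0 <= B /\ forall xi : plane, Rabs (clipped_gen i (J kappa xi)) <= B.
Proof.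
  destruct (bounded_on_segment (F i) 0 rho') as [B [hB hb]]; [intros; apply hF |].
  exists B. split; [exact hB |]. intros xi. apply hb. split; [| apply Rmin_r].
  apply Rmin_glb; [| lra]. unfold J. apply Rmult_le_pos; [lra | apply pow2_ge_0].
Qed.

Lemma clipped_system_lipschitz (omega : R) :
  exists L, 0 < L /\ forall t x y,
    norm (minus (clipped_system omega t x) (clipped_system omega t y)) <= L * norm (minus x y).
Proof.
  destruct (clipped_gen_lipschitz Defs.one) as [M1 [hM1 h1]].
  destruct (clipped_gen_lipschitz Defs.two) as [M2 [hM2 h2]].
  set (A := sqrt (theta * (4 * (1 - / INR k ^ 2)) * omega)).
  assert (hA : 0 <= A) by apply sqrt_pos.
  exists (A * (M1 + M2) + 1). split.
  { assert (0 <= A * (M1 + M2)) by (apply Rmult_le_pos; lra). lra. }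
  intros t x y. unfold clipped_system, unicycle, control.
  rewrite norm_minus_polar. fold A.
  set (xi := minus x (gamma (Rmax 0 t))). set (eta := minus y (gamma (Rmax 0 t))).
  assert (hxe : norm (minus xi eta) = norm (minus x y)).
  { f_equal. unfold xi, eta, minus. rewrite (opp_plus (G := plane)), (opp_opp (G := plane)).
    rewrite <- (plus_assoc (G := plane)). f_equal.
    rewrite (plus_comm (G := plane) (opp y)), (plus_assoc (G := plane)).
    exact (eq_trans (f_equal (fun z => plus z (opp y)) (plus_opp_l _)) (plus_zero_l _)). }
  specialize (h1 xi eta). specialize (h2 xi eta). rewrite hxe in h1, h2.
  set (n := norm (minus x y)) in *. assert (hn : 0 <= n) by apply norm_ge_0.
  set (a1 := clipped_gen Defs.one (J kappa xi)) in *.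
  set (b1 := clipped_gen Defs.one (J kappa eta)) in *.
  set (a2 := clipped_gen Defs.two (J kappa xi)) in *.
  set (b2 := clipped_gen Defs.two (J kappa eta)) in *.
  replace (A * (a1 * cos (omega * t) + a2 * sin (omega * t))
           - A * (b1 * cos (omega * t) + b2 * sin (omega * t)))
    with (A * ((a1 - b1) * cos (omega * t) + (a2 - b2) * sin (omega * t))) by ring.
  rewrite Rabs_mult, (Rabs_pos_eq A) by exact hA.
  pose proof (Rabs_cos_le (omega * t)). pose proof (Rabs_sin_le (omega * t)).
  assert (Rabs ((a1 - b1) * cos (omega * t) + (a2 - b2) * sin (omega * t)) <= (M1 + M2) * n).
  { eapply Rle_trans; [apply Rabs_triang |]. rewrite !Rabs_mult.
    pose proof (Rabs_pos (a1 - b1)). pose proof (Rabs_pos (a2 - b2)).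
    pose proof (Rabs_pos (cos (omega * t))). pose proof (Rabs_pos (sin (omega * t))). nra. }
  assert (A * Rabs ((a1 - b1) * cos (omega * t) + (a2 - b2) * sin (omega * t))
          <= A * ((M1 + M2) * n))
    by (apply Rmult_le_compat_l; assumption).
  lra.
Qed.

Lemma clipped_system_bounded (omega : R) :
  exists M, forall t x, norm (clipped_system omega t x) <= M.
Proof.
  destruct (clipped_gen_bounded Defs.one) as [B1 [hB1 h1]].
  destruct (clipped_gen_bounded Defs.two) as [B2 [hB2 h2]].
  set (A := sqrt (theta * (4 * (1 - / INR k ^ 2)) * omega)).
  assert (hA : 0 <= A) by apply sqrt_pos.
  exists (A * (B1 + B2)). intros t x. unfold clipped_system, unicycle, control.
  rewrite norm_polar. fold A.
  rewrite Rabs_mult, (Rabs_pos_eq A) by exact hA. apply Rmult_le_compat_l; [exact hA |].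
  specialize (h1 (minus x (gamma (Rmax 0 t)))). specialize (h2 (minus x (gamma (Rmax 0 t)))).
  pose proof (Rabs_cos_le (omega * t)). pose proof (Rabs_sin_le (omega * t)).
  eapply Rle_trans; [apply Rabs_triang |]. rewrite !Rabs_mult.
  pose proof (Rabs_pos (cos (omega * t))). pose proof (Rabs_pos (sin (omega * t))).
  apply Rplus_le_compat; [rewrite <- (Rmult_1_r B1) | rewrite <- (Rmult_1_r B2)];
    apply Rmult_le_compat; auto using Rabs_pos.
Qed.

Lemma clipped_system_continuous (omega : R) (x : plane) (t : R) :
  continuous (fun s => clipped_system omega s x) t.
Proof.
  assert (htrig : forall h : R -> R, (forall y, continuous h y) ->
            forall c, continuous (fun s => h (c * s)) t).
  { intros h hh c. apply (continuous_comp (fun s => c * s) h); [| apply hh].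
    apply (ex_derive_continuous (V := R_NormedModule)). auto_derive. trivial. }
  assert (hgen : forall i, continuous
            (fun s => clipped_gen i (J kappa (minus x (gamma (Rmax 0 s))))) t).
  { intros i. unfold clipped_gen.
    apply (continuous_comp (fun s => Rmin (J kappa (minus x (gamma (Rmax 0 s)))) rho') (F i));
      [| apply hF].
    apply (continuous_comp (fun s => J kappa (minus x (gamma (Rmax 0 s)))) (fun z => Rmin z rho'));
      [| apply continuous_Rmin].
    apply (continuous_comp (fun s => minus x (gamma (Rmax 0 s))) (J kappa)); [| apply continuous_J].
    apply (continuous_minus (V := plane) (fun _ => x) (fun s => gamma (Rmax 0 s)));
      [apply continuous_const |].
    apply (continuous_comp (fun s => Rmax 0 s) gamma); [apply continuous_Rmax |].
    apply (is_derive2_continuous gamma _ (dgamma (Rmax 0 t))), hgamma, Rmax_l. }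
  unfold clipped_system, unicycle, control.
  assert (hu : continuous (fun s => sqrt (theta * (4 * (1 - / INR k ^ 2)) * omega) *
      (clipped_gen Defs.one (J kappa (minus x (gamma (Rmax 0 s)))) * cos (omega * s) +
       clipped_gen Defs.two (J kappa (minus x (gamma (Rmax 0 s)))) * sin (omega * s))) t).
  { apply (continuous_mult (K := R_AbsRing)); [apply continuous_const |].
    apply (continuous_plus (V := R_NormedModule));
      apply (continuous_mult (K := R_AbsRing)); auto.
    - apply (htrig cos), continuous_cos.
    - apply (htrig sin), continuous_sin. }
  apply continuous_pair; apply (continuous_mult (K := R_AbsRing)); try exact hu.
  - apply (htrig cos), continuous_cos.
  - apply (htrig sin), continuous_sin.
Qed.

Lemma clipped_solution (omega t0 : R) (x0 : plane) :
  exists y : R -> plane, y t0 = x0 /\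
    forall t, t0 <= t -> is_derive2 y t (clipped_system omega t (y t)).
Proof.
  destruct (clipped_system_lipschitz omega) as [L [hL hlip]].
  destruct (clipped_system_bounded omega) as [M hM].
  destruct (picard_existence (E := C_R_CompleteNormedModule) (clipped_system omega) L M t0 x0
    hL hlip hM (clipped_system_continuous omega)) as [y [hy0 hy]].
  exists y. split; [exact hy0 |]. intros t ht. now apply is_derive_is_derive2, hy.
Qed.

Lemma clipped_system_eq (omega t : R) (x : plane) :
  0 <= t -> J kappa (minus x (gamma t)) <= rho' -> clipped_system omega t x = system omega t x.
Proof.
  intros ht hJ. unfold clipped_system, system, unicycle, control, clipped_gen.
  now rewrite (Rmax_right 0 t), Rmin_left.
Qed.

(** Satisfied by the solutions of both the given and the clipped system, so that
    one barrier argument serves for the two. *)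
Definition steered (omega : R) (y : R -> plane) (t : R) : Prop :=
  exists v, is_derive2 y t v /\
    (J kappa (minus (y t) (gamma t)) <= rho' -> v = system omega t (y t)).

Definition offset (y : R -> plane) (t : R) : plane := minus (y t) (gamma t).

Definition gain : R := sqrt (theta * (4 * (1 - / INR k ^ 2))).

Definition decrease_rate : R :=
  2 * sqrt (kappa * lambda) * (2 * theta * sqrt (kappa * lambda) - nu).

(** Uniform over all steered paths and all times: this is where the thresholds on
    [omega] come from. *)
Definition lyapunov_accuracy (omega eta : R) : Prop :=
  forall y t, 0 <= t -> steered omega y t -> lambda <= J kappa (offset y t) <= rho' ->
    approx_lyapunov (fun s => J kappa (offset y s))
      (annular_lyapunov kappa (/ INR k) gain F omega (offset y) dgamma)
      (decrease_rate - eta) eta t.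

Lemma ratio_bounds : 0 < / INR k < 1.
Proof.
  assert (h : 1 < INR k) by (apply (lt_INR 1); exact hk).
  split; [apply Rinv_0_lt_compat; lra |]. rewrite <- Rinv_1. apply Rinv_lt_contravar; lra.
Qed.

Lemma decrease_rate_pos : 0 < decrease_rate.
Proof.
  unfold decrease_rate. apply Rmult_lt_0_compat; [| lra].
  apply Rmult_lt_0_compat; [lra |]. apply sqrt_lt_R0, Rmult_lt_0_compat; lra.
Qed.

Lemma steered_error (omega : R) (y : R -> plane) (t : R) :
  0 <= omega -> 0 <= t -> steered omega y t -> J kappa (offset y t) <= rho' ->
  is_derive2 (offset y) t
    (unicycle_error_velocity kappa (/ INR k) gain F omega t (offset y t) (dgamma t)).
Proof.
  intros ho ht [v [hv hsys]] hJ.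
  replace (unicycle_error_velocity _ _ _ _ _ _ _ _) with (minus v (dgamma t)).
  - apply is_derive2_minus; [exact hv | now apply hgamma].
  - rewrite (hsys hJ). unfold system, unicycle, control, unicycle_error_velocity, oscillation, gain.
    pose proof ratio_bounds as hq.
    assert (hq2 : / INR k ^ 2 < 1) by (rewrite <- pow_inv; nra).
    rewrite (sqrt_mult (theta * (4 * (1 - / INR k ^ 2))) omega);
      [| apply Rmult_le_pos; lra | exact ho].
    replace (omega / INR k * t) with (/ INR k * omega * t) by (unfold Rdiv; ring).
    reflexivity.
Qed.

Lemma eventually_accurate (eta : R) : 0 < eta ->
  exists omega0, 0 < omega0 /\ forall omega, omega0 < omega -> lyapunov_accuracy omega eta.
Proof.
  intros heta.
  pose proof ratio_bounds as hq.
  assert (hq2 : / INR k ^ 2 < 1) by (rewrite <- pow_inv; nra).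
  assert (hg : gain ^ 2 = 4 * theta * (1 - (/ INR k) ^ 2)).
  { unfold gain. rewrite pow2_sqrt, pow_inv; [ring |]. apply Rmult_le_pos; lra. }
  destruct (annular_decrease kappa (/ INR k) gain theta nu lambda rho' F) as [K [hK hdec]];
    try assumption; try lra.
  - intros i z hz. apply (profile_C2 kappa rho F hkappa i z (hC2 i)). lra.
  - intros z hz. apply (wronskian kappa rho F hkappa z hrel hF hC2). lra.
  - exists (1 + (K / eta) ^ 2). split; [pose proof (pow2_ge_0 (K / eta)); lra |].
    intros omega ho y t ht hs hz.
    pose proof (pow2_ge_0 (K / eta)) as hp.
    assert (hKe : 0 < K / eta) by (apply Rdiv_lt_0_compat; lra).
    assert (hsq : K / eta <= sqrt omega).
    { rewrite <- (sqrt_pow2 (K / eta)) by lra. apply sqrt_le_1_alt. lra. }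
    assert (hle : K / sqrt omega <= eta).
    { apply Rle_div_l; [lra |]. apply Rle_div_l in hsq; [| lra]. lra. }
    destruct (hdec omega (offset y) dgamma t) as [h1 [l [h2 h3]]].
    + lra.
    + apply steered_error; try assumption; lra.
    + now apply hdgamma.
    + exact hz.
    + split; [lra |]. exists l. split; [exact h2 |]. unfold decrease_rate. lra.
Qed.

Lemma offset_continuous (omega : R) (y : R -> plane) (t : R) :
  0 <= t -> steered omega y t -> continuous (fun s => J kappa (offset y s)) t.
Proof.
  intros ht [v [hv _]].
  apply (continuous_comp (offset y) (J kappa)); [| apply continuous_J].
  exact (is_derive2_continuous _ _ _ (is_derive2_minus _ _ _ _ _ hv (hgamma t ht))).
Qed.

Lemma steered_barrier (omega eta a b t0 t1 : R) (y : R -> plane) :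
  lyapunov_accuracy omega eta -> eta <= decrease_rate -> 2 * eta < b - a ->
  lambda <= a -> a < b -> b <= rho' -> 0 <= t0 -> t0 <= t1 ->
  (forall t, t0 <= t <= t1 -> steered omega y t) ->
  J kappa (offset y t0) <= a -> J kappa (offset y t1) < b.
Proof.
  intros hacc heta hab ha hlt hb ht0 ht1 hs h0.
  apply (barrier (fun s => J kappa (offset y s))
    (annular_lyapunov kappa (/ INR k) gain F omega (offset y) dgamma) t0 t1 a b
    (decrease_rate - eta) eta); try assumption; try lra.
  - intros t ht. apply (offset_continuous omega); [lra | apply hs; lra].
  - intros t ht hz. apply hacc; [lra | apply hs; lra | lra].
Qed.

Lemma steered_entry (omega eta t0 t1 : R) (y : R -> plane) :
  lyapunov_accuracy omega eta ->
  rho' - lambda + 2 * eta < (decrease_rate - eta) * (t1 - t0) ->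
  0 <= t0 -> t0 <= t1 ->
  (forall t, t0 <= t <= t1 -> steered omega y t /\ J kappa (offset y t) <= rho') ->
  exists t, t0 <= t <= t1 /\ J kappa (offset y t) <= lambda.
Proof.
  intros hacc hlong ht0 ht1 hs.
  apply (entry (fun s => J kappa (offset y s))
    (annular_lyapunov kappa (/ INR k) gain F omega (offset y) dgamma) t0 t1 lambda rho'
    (decrease_rate - eta) eta); try assumption.
  - intros t ht hz. apply hacc; [lra | now apply hs | lra].
  - intros t ht. now apply hs.
Qed.

Lemma solution_extends (omega t0 : R) (x0 : plane) (T : Rbar) (x : R -> plane) :
  solution (system omega) t0 x0 T x ->
  exists y, (forall t, t0 <= t -> y t = x t) /\ y t0 = x0 /\
    forall t, t0 <= t -> Rbar_lt t T -> is_derive2 y t (system omega t (y t)).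
Proof.
  intros [hT [hx0 hx]].
  destruct (extend_path x (fun t => system omega t (x t)) t0 T hx) as [y [he hd]].
  exists y. split; [exact he |]. split; [rewrite he by lra; exact hx0 |].
  intros t ht htT. rewrite he by exact ht. now apply hd.
Qed.

Lemma system_steered (omega t : R) (y : R -> plane) :
  is_derive2 y t (system omega t (y t)) -> steered omega y t.
Proof. intros h. now exists (system omega t (y t)). Qed.

Lemma clipped_steered (omega t : R) (y : R -> plane) : 0 <= t ->
  is_derive2 y t (clipped_system omega t (y t)) -> steered omega y t.
Proof.
  intros ht h. exists (clipped_system omega t (y t)). split; [exact h |].
  intros hJ. now apply clipped_system_eq.
Qed.

(** Both systems confine their solutions to the level [rho'], where they
    coincide.  So the global solution of the clipped system solves the given one, and
    any local solution of the latter is, by uniqueness, a restriction of it: no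
    separate continuation argument is needed. *)
Lemma solutions_in_sublevel (omega eta a t0 t1 : R) (x0 : plane) (U : R -> plane -> Prop) :
  lyapunov_accuracy omega eta -> eta <= decrease_rate -> 2 * eta < rho' - a ->
  lambda <= a -> a < rho' -> 0 <= t0 -> t0 <= t1 ->
  J kappa (minus x0 (gamma t0)) <= a ->
  (forall y, y t0 = x0 ->
     (forall t, t0 <= t -> steered omega y t /\ J kappa (offset y t) <= rho') ->
     forall t, t1 <= t -> U t (y t)) ->
  solutions_in (system omega) t0 x0 t1 U.
Proof.
  intros hacc heta h2 ha har ht0 ht1 hx0 hU.
  assert (hconf : forall y t, t0 <= t -> y t0 = x0 ->
            (forall s, t0 <= s <= t -> steered omega y s) -> J kappa (offset y t) <= rho').
  { intros y t ht hy hs. apply Rlt_le.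
    apply (steered_barrier omega eta a rho' t0 t y); try assumption; try lra.
    unfold offset. rewrite hy. exact hx0. }
  destruct (clipped_solution omega t0 x0) as [y [hy0 hy]].
  assert (hyJ : forall t, t0 <= t -> J kappa (offset y t) <= rho').
  { intros t ht. apply hconf; [exact ht | exact hy0 |]. intros s hs.
    apply clipped_steered; [lra |]. apply hy. lra. }
  assert (hysol : solution (system omega) t0 x0 p_infty y).
  { split; [exact I |]. split; [exact hy0 |]. intros t ht _. apply is_derive2_within.
    rewrite <- clipped_system_eq; [now apply hy | lra | now apply hyJ]. }
  split; [now exists y |]. split.
  - intros T x hx. exists y. split; [exact hysol |]. intros t ht htT.
    destruct (solution_extends omega t0 x0 T x hx) as [x' [he [hx'0 hx']]].
    rewrite <- he by exact ht.
    assert (hbefore : forall s, s <= t -> Rbar_lt s T)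
      by (intros s hs; now apply Rbar_le_lt_trans with t).
    destruct (clipped_system_lipschitz omega) as [L [_ hL]].
    apply (lipschitz_unique (clipped_system omega) L t0 t); [exact ht | exact hL | |].
    + intros s hs. split; [apply hy; lra |].
      rewrite clipped_system_eq; [apply hx'; [lra | apply hbefore; lra] | lra |].
      apply (hconf x' s); [lra | exact hx'0 |].
      intros r hr. apply system_steered, hx'; [lra | apply hbefore; lra].
    + now rewrite hx'0.
  - intros x hx t ht.
    destruct (solution_extends omega t0 x0 p_infty x hx) as [x' [he [hx'0 hx']]].
    rewrite <- he by lra.
    assert (hs : forall s, t0 <= s -> steered omega x' s)
      by (intros s hs; apply system_steered, hx'; [exact hs | exact I]).
    apply hU; [exact hx'0 | | exact ht].
    intros s hs0. split; [now apply hs |].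
    apply hconf; [exact hs0 | exact hx'0 |]. intros r hr. apply hs. lra.
Qed.

Lemma solutions_confined (a b : R) :
  lambda <= a -> a < b -> b <= rho' ->
  exists omega0, 0 < omega0 /\ forall omega t0 x0, omega0 < omega -> 0 <= t0 ->
    J kappa (minus x0 (gamma t0)) <= a ->
    solutions_in (system omega) t0 x0 t0 (fun t x => J kappa (minus x (gamma t)) < b).
Proof.
  intros ha hab hb. pose proof decrease_rate_pos as hr.
  set (eta := Rmin decrease_rate ((b - a) / 3)).
  assert (h1 : eta <= decrease_rate) by apply Rmin_l.
  assert (h2 : eta <= (b - a) / 3) by apply Rmin_r.
  destruct (eventually_accurate eta) as [omega0 [ho hacc]]; [apply Rmin_pos; lra |].
  exists omega0. split; [exact ho |]. intros omega t0 x0 hom ht0 hx0.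
  apply (solutions_in_sublevel omega eta a); try assumption; try lra; [now apply hacc |].
  intros y hy hs t ht.
  apply (steered_barrier omega eta a b t0 t y); try assumption; try lra.
  - now apply hacc.
  - intros s hst. apply hs. lra.
  - unfold offset. now rewrite hy.
Qed.

(** The path reaches the level [lambda] within a time that depends neither on
    [t0] nor on [omega], and from there the barrier between [lambda] and [b] holds. *)
Lemma solutions_attracted (a b : R) :
  lambda <= a -> a < rho' -> lambda < b -> b <= rho' ->
  exists t1 omega0, 0 <= t1 /\ 0 < omega0 /\ forall omega t0 x0, omega0 < omega -> 0 <= t0 ->
    J kappa (minus x0 (gamma t0)) <= a ->
    solutions_in (system omega) t0 x0 (t0 + t1) (fun t x => J kappa (minus x (gamma t)) < b).
Proof.
  intros ha har hb hbr. pose proof decrease_rate_pos as hr.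
  set (eta := Rmin (decrease_rate / 2) (Rmin ((b - lambda) / 3) ((rho' - a) / 3))).
  assert (h1 : eta <= decrease_rate / 2) by apply Rmin_l.
  assert (h2 : eta <= (b - lambda) / 3) by (eapply Rle_trans; [apply Rmin_r | apply Rmin_l]).
  assert (h3 : eta <= (rho' - a) / 3) by (eapply Rle_trans; [apply Rmin_r | apply Rmin_r]).
  assert (h0 : 0 < eta) by (repeat apply Rmin_pos; lra).
  destruct (eventually_accurate eta h0) as [omega0 [ho hacc]].
  set (t1 := 2 * (rho' - lambda + 2 * eta) / decrease_rate + 1).
  assert (ht1 : rho' - lambda + 2 * eta < decrease_rate / 2 * t1).
  { replace (decrease_rate / 2 * t1) with (rho' - lambda + 2 * eta + decrease_rate / 2)
      by (unfold t1; field; lra). lra. }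
  assert (ht1' : 0 <= t1).
  { unfold t1. assert (0 <= 2 * (rho' - lambda + 2 * eta) / decrease_rate)
      by (apply Rle_mult_inv_pos; lra). lra. }
  exists t1, omega0. split; [exact ht1' |]. split; [exact ho |].
  intros omega t0 x0 hom ht0 hx0. specialize (hacc omega hom).
  apply (solutions_in_sublevel omega eta a); try assumption; try lra.
  intros y hy hs t ht.
  destruct (steered_entry omega eta t0 (t0 + t1) y) as [s [hst hsl]]; try assumption; try lra.
  - replace (t0 + t1 - t0) with t1 by ring.
    apply Rlt_le_trans with (1 := ht1). apply Rmult_le_compat_r; lra.
  - intros s hst. apply hs. lra.
  - apply (steered_barrier omega eta lambda b s t y); try assumption; try lra.
    intros r hr'. apply hs. lra.
Qed.

End Unicycle.

Lemma solutions_in_mono (f h : R -> plane -> plane) (t0 t1 : R) (x0 : plane)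
    (U V : R -> plane -> Prop) :
  (forall t x, t0 <= t -> f t x = h t x) ->
  (forall t x, t1 <= t -> U t x -> V t x) ->
  solutions_in f t0 x0 t1 U -> solutions_in h t0 x0 t1 V.
Proof.
  intros hfh hUV [[x hx] [hcont hU]].
  assert (tr : forall f h : R -> plane -> plane, (forall t x, t0 <= t -> f t x = h t x) ->
            forall T x, solution f t0 x0 T x -> solution h t0 x0 T x).
  { intros f' h' he T y [h1 [h2 h3]]. split; [exact h1 |]. split; [exact h2 |].
    intros t ht hT. rewrite <- he by exact ht. now apply h3. }
  assert (hhf : forall t x, t0 <= t -> h t x = f t x) by (intros; symmetry; auto).
  split; [exists x; now apply (tr f h) |]. split.
  - intros T y hy. destruct (hcont T y (tr h f hhf T y hy)) as [z [hz hzy]].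
    exists z. split; [now apply (tr f h) | exact hzy].
  - intros y hy t ht. apply hUV; [exact ht |]. apply hU; [now apply (tr h f) | exact ht].
Qed.

Theorem theorem3 (kappa rho : R) (F : index -> R -> R) (gamma : R -> plane)
    (nu : R) (k : nat) (lambda delta theta : R)
    (hkappa : 0 < kappa) (hrho : 0 < rho)
    (hF : forall (i : index) (z : R), continuous (F i) z)
    (hFrel : integral_relation F)
    (hB1 : condition_B1 kappa rho F)
    (hB2 : condition_B2 kappa rho F)
    (hB3 : condition_B3 gamma nu)
    (hk : (1 < k)%nat)
    (hlambda : 0 < lambda < rho)
    (hdelta : 0 < delta < (sqrt rho - sqrt lambda) / sqrt kappa)
    (htheta : nu / (2 * sqrt (kappa * lambda)) < theta) :
  practically_uniformly_asymptotically_stable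
    (unicycle k (control kappa theta k F gamma))
    (level_sets kappa lambda gamma) delta.
Proof.
  destruct hB1 as [hC2 _]. destruct hB2 as [hbp _].
  destruct hB3 as [hnu [dgamma [_ hgamma]]].
  destruct (extend_path gamma dgamma 0 p_infty) as [gam [hgam hdgam]].
  { intros t ht _. apply is_derive_within_slopes.
    destruct (proj1 (is_derive_within_slopes _ _ _ _) (proj1 (hgamma t ht))) as [h1 h2].
    split; intros eps.
    - destruct (h1 eps) as [d hd]. exists d. intros s hs. now apply hd.
    - destruct (h2 eps) as [d hd]. exists d. intros s hs. now apply hd. }
  assert (hgam' : forall t, 0 <= t -> is_derive2 gam t (dgamma t))
    by (intros t ht; now apply hdgam).
  assert (hdg : forall t, 0 <= t -> norm (dgamma t) <= nu) by (intros t ht; now apply hgamma).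
  assert (hs0 : 0 < sqrt (kappa * lambda))
    by (apply sqrt_lt_R0, Rmult_lt_0_compat; lra).
  assert (hgap : nu < 2 * theta * sqrt (kappa * lambda)).
  { apply Rlt_div_l in htheta; lra. }
  assert (hth : 0 < theta).
  { apply Rle_lt_trans with (2 := htheta). apply Rle_mult_inv_pos; lra. }
  set (r0 := sqrt (lambda / kappa)).
  assert (hr0 : 0 < r0) by (apply sqrt_lt_R0, Rdiv_lt_0_compat; lra).
  assert (hr2 : kappa * r0 ^ 2 = lambda).
  { unfold r0. rewrite pow2_sqrt; [field; lra |]. apply Rle_mult_inv_pos; lra. }
  (* The distance of [x] from the disc of radius [r0] around [gamma t] is less than
     [d] exactly when its energy is less than [level d]. *)
  set (level := fun d => kappa * (r0 + d) ^ 2).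
  assert (hlev : forall c d, 0 <= c -> c < d -> level c < level d).
  { intros c d hc hcd. apply Rmult_lt_compat_l; [exact hkappa |].
    simpl. rewrite !Rmult_1_r. apply Rmult_le_0_lt_compat; lra. }
  assert (hlev0 : level 0 = lambda) by (unfold level; rewrite Rplus_0_r; exact hr2).
  assert (hlrho : level delta < rho).
  { assert (hsk : 0 < sqrt kappa) by now apply sqrt_lt_R0.
    destruct hdelta as [hd0 hd]. apply Rlt_div_r in hd; [| exact hsk].
    assert (hsl : sqrt kappa * r0 = sqrt lambda).
    { unfold r0. rewrite <- sqrt_mult; [f_equal; field; lra | lra |].
      apply Rle_mult_inv_pos; lra. }
    assert (hlt : sqrt kappa * (r0 + delta) < sqrt rho) by lra.
    assert (hkk : sqrt kappa * sqrt kappa = kappa) by (apply sqrt_sqrt; lra).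
    assert (hrr : sqrt rho * sqrt rho = rho) by (apply sqrt_sqrt; lra).
    assert (hpos : 0 <= sqrt kappa * (r0 + delta)) by (apply Rmult_le_pos; lra).
    replace (level delta) with ((sqrt kappa * (r0 + delta)) * (sqrt kappa * (r0 + delta)))
      by (unfold level; rewrite <- hkk at 3; ring).
    rewrite <- hrr. apply Rmult_le_0_lt_compat; lra. }
  (* Strictly between the initial energies and the boundary of the
     disc where the generators are regular, to leave room for the oscillation. *)
  set (rho' := (level delta + rho) / 2).
  assert (hld : lambda < level delta) by (rewrite <- hlev0; apply hlev; lra).
  pose proof (solutions_confined kappa rho rho' nu lambda theta F gam dgamma k hkappa hF hC2
    hbp hFrel hk ltac:(unfold rho'; lra) ltac:(unfold rho'; lra) (Rlt_le _ _ hnu) hth hgap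
    hgam' hdg) as hconf.
  pose proof (solutions_attracted kappa rho rho' nu lambda theta F gam dgamma k hkappa hF hC2
    hbp hFrel hk ltac:(unfold rho'; lra) ltac:(unfold rho'; lra) (Rlt_le _ _ hnu) hth hgap
    hgam' hdg) as hattr.
  assert (hsys : forall omega t x, 0 <= t ->
            system kappa theta F gam k omega t x
            = unicycle k (control kappa theta k F gamma) omega t x).
  { intros omega t x ht. unfold system, unicycle, control. now rewrite hgam. }
  assert (hin : forall d t0 x0, 0 <= t0 -> nbhd d (level_sets kappa lambda gamma t0) x0 ->
            J kappa (minus x0 (gam t0)) <= level d).
  { intros d t0 x0 ht0 hx0. rewrite hgam by exact ht0.
    apply (nbhd_level_set kappa lambda d gamma t0 x0); try assumption; lra. }
  assert (hout : forall eps t x, 0 < eps -> 0 <= t -> J kappa (minus x (gam t)) < level eps ->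
            nbhd eps (level_sets kappa lambda gamma t) x).
  { intros eps t x heps ht hx. rewrite hgam in hx by exact ht.
    apply level_set_nbhd; try assumption; lra. }
  split; [| split].
  - intros eps heps.
    set (d := Rmin delta (eps / 2)).
    assert (hd0 : 0 < d) by (apply Rmin_pos; lra).
    assert (hd1 : d <= delta) by apply Rmin_l.
    assert (hd2 : d <= eps / 2) by apply Rmin_r.
    assert (hle : level d <= level delta).
    { destruct hd1 as [hlt | ->]; [apply Rlt_le, hlev |]; lra. }
    destruct (hconf (level d) (Rmin (level eps) rho')) as [omega0 [ho hsol]].
    + rewrite <- hlev0. apply Rlt_le, hlev; lra.
    + apply Rmin_glb_lt; [apply hlev; lra | unfold rho'; lra].
    + apply Rmin_r.
    + exists d, omega0. split; [lra |]. split; [exact ho |].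
      intros t0 omega x0 ht0 hom hx0.
      eapply solutions_in_mono; [| | exact (hsol omega t0 x0 hom ht0 (hin d t0 x0 ht0 hx0))].
      * intros t x ht. apply hsys. lra.
      * intros t x ht hx. apply hout; [exact heps | lra |].
        apply Rlt_le_trans with (1 := hx). apply Rmin_l.
  - intros eps heps.
    destruct (hattr (level delta) (Rmin (level eps) rho')) as [t1 [omega0 [ht1 [ho hsol]]]].
    + lra.
    + unfold rho'; lra.
    + apply Rmin_glb_lt; [rewrite <- hlev0; apply hlev; lra | unfold rho'; lra].
    + apply Rmin_r.
    + exists t1, omega0. split; [exact ht1 |]. split; [exact ho |].
      intros t0 omega x0 ht0 hom hx0.
      eapply solutions_in_mono; [| | exact (hsol omega t0 x0 hom ht0 (hin delta t0 x0 ht0 hx0))].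
      * intros t x ht. apply hsys. lra.
      * intros t x ht hx. apply hout; [exact heps | lra |].
        apply Rlt_le_trans with (1 := hx). apply Rmin_l.
  - intros d [hd0 hd1].
    assert (hle : level d <= level delta).
    { destruct hd1 as [hlt | ->]; [apply Rlt_le, hlev |]; lra. }
    destruct (hconf (level d) rho') as [omega0 [ho hsol]].
    + rewrite <- hlev0. apply Rlt_le, hlev; lra.
    + unfold rho'; lra.
    + lra.
    + assert (hrp : 0 < rho' / kappa) by (apply Rdiv_lt_0_compat; [unfold rho'; lra | lra]).
      assert (he : 0 < sqrt (rho' / kappa)) by now apply sqrt_lt_R0.
      exists (sqrt (rho' / kappa)), omega0. split; [exact he |]. split; [exact ho |].
      intros t0 omega x0 ht0 hom hx0.
      eapply solutions_in_mono; [| | exact (hsol omega t0 x0 hom ht0 (hin d t0 x0 ht0 hx0))].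
      * intros t x ht. apply hsys. lra.
      * intros t x ht hx. apply hout; [exact he | lra |].
        apply Rlt_le_trans with (1 := hx). unfold level.
        replace rho' with (kappa * sqrt (rho' / kappa) ^ 2) at 1
          by (rewrite pow2_sqrt; [field; lra | lra]).
        apply Rmult_le_compat_l; [lra |]. apply pow_incr. lra.
Qed.
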